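(* Let $n\geq 3$ and let $K$ be an algebraically closed field of characteristic zero. Then for every nonzero multilinear polynomial $f(x_1,x_2,x_3,x_4)\in K\langle x_1,x_2,x_3,x_4\rangle$, the image $f(M_n(K))$ contains $sl_n(K)$.
   Context: $K\langle x_1,\dots,x_4\rangle$ is the free associative algebra on noncommuting variables. A polynomial is multilinear if it has the form $\sum_{\sigma\in S_4}\alpha_\sigma x_{\sigma(1)}x_{\sigma(2)}x_{\sigma(3)}x_{\sigma(4)}$ with $\alpha_\sigma\in K$. $f(M_n(K))=\{f(a_1,\dots,a_4): a_i\in M_n(K)\}$, and $sl_n(K)$ is the set of trace zero $n\times n$ matrices over $K$. *)

(* Defs.v *)
From HB Require Import structures.
From mathcomp Require Import all_boot all_order all_fingroup all_algebra.
Set Implicit Arguments. Unset Strict Implicit. Unset Printing Implicit Defensive.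
Import GRing.Theory.
Local Open Scope ring_scope.

(* A multilinear polynomial in x_1..x_4 (indexed here by 'I_4 = {0,1,2,3})
   is given by its coefficient family alpha : 'S_4 -> K, representing
   sum_sigma alpha_sigma x_{sigma 0} x_{sigma 1} x_{sigma 2} x_{sigma 3}. *)
Definition multilin_eval (K : fieldType) (n : nat)
    (alpha : {ffun 'S_4 -> K}) (a : 'I_4 -> 'M[K]_n) : 'M[K]_n :=
  \sum_(s : 'S_4) alpha s *: (a (s 0) *m a (s 1) *m a (s 2) *m a (s 3)).

Definition multilin_image (K : fieldType) (n : nat) (alpha : {ffun 'S_4 -> K})
    (A : 'M[K]_n) : Prop :=
  exists a : 'I_4 -> 'M[K]_n, multilin_eval alpha a = A.

(* Main.v *)
Require Import Defs.
From HB Require Import structures.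
From mathcomp Require Import all_boot all_order all_fingroup all_algebra.
From mathcomp Require Import ring.
Set Implicit Arguments. Unset Strict Implicit. Unset Printing Implicit Defensive.
Import GRing.Theory.
Local Open Scope ring_scope.

(** The image is closed under conjugation and every traceless matrix is similar to one with zero
    diagonal, so it suffices to reach the matrices [A] with zero diagonal. Let [D] be diagonal with
    distinct entries; then [A = ad_D^m (Z)] has a solution [Z] for every [m].

    If [f(1, x, y, z)] is nonzero for some placement of the unit, then [f] covers [A] by the same
    argument in degree at most three, using [ad_D] and [ad_D^2]. Otherwise [f(D, D, D, Z)] is a
    multiple of [ad_D^3 (Z)]; if this multiple is zero for every placement of [Z], then
    [f(x, x, y, z) = p [x,y] [x,z] + q [x,z] [x,y]]. If [p] or [q] is nonzero for some choice of the
    repeated variable, the task is to write [A = p U V + q V U] with [U] and [V] in the image of one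
    [ad_D], where [D] is now arbitrary. If they always vanish then [f] is a multiple of the standard
    polynomial [s_4], and [s_4(D, D^2, Y, Z)] is [[D, [U, V]]] up to sign, with [U = [D, Y]] and
    [V = [D, Z]].

    Both tasks are solved block by block. If [V] is invertible on a diagonal block then, after a
    generic rescaling of [U] and [V] and a generic scalar shift of [D] on that block, the
    off-diagonal blocks of [A] are obtained by solving linear equations. It remains to treat blocks
    of size 2 (when [p <> q]) or 3, and a last block of size at most 5. *)

(** * Similarity and zero diagonals *)

Section Similarity.

Variable K : fieldType.

Definition mxcomm n (A B : 'M[K]_n) : 'M[K]_n := A *m B - B *m A.

Definition zero_diag n (A : 'M[K]_n) : Prop := forall i, A i i = 0.

Definition similar_mx n (A B : 'M[K]_n) : Prop :=
  exists2 P, P \in unitmx & P *m A = B *m P.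

Lemma similar_mx_refl n (A : 'M[K]_n) : similar_mx A A.
Proof. by exists 1%:M; rewrite ?unitmx1 // mul1mx mulmx1. Qed.

Lemma similar_mx_trans n (B A C : 'M[K]_n) :
  similar_mx A B -> similar_mx B C -> similar_mx A C.
Proof.
move=> [P uP AB] [Q uQ BC]; exists (Q *m P); first by rewrite unitmx_mul uQ.
by rewrite -mulmxA AB !mulmxA BC.
Qed.

Lemma similar_mxE n (A B P : 'M[K]_n) :
  P \in unitmx -> P *m A = B *m P -> A = invmx P *m B *m P.
Proof. by move=> uP AB; rewrite -mulmxA -AB mulKmx. Qed.

Lemma similar_mx_trace n (A B : 'M[K]_n) : similar_mx A B -> \tr A = \tr B.
Proof.
by move=> [P uP /(similar_mxE uP) ->]; rewrite mxtrace_mulC mulmxA mulmxV // mul1mx.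
Qed.

Lemma mxcomm_conj n (P A B : 'M[K]_n) : P \in unitmx ->
  mxcomm (invmx P *m A *m P) (invmx P *m B *m P) = invmx P *m mxcomm A B *m P.
Proof.
move=> uP; rewrite /mxcomm mulmxBr mulmxBl; congr (_ - _);
by rewrite !mulmxA mulmxK.
Qed.

Lemma mxcomm_block n1 n2 (D1 A1 : 'M[K]_n1) (D2 A2 : 'M[K]_n2) B C :
  mxcomm (block_mx D1 0 0 D2) (block_mx A1 B C A2) =
  block_mx (mxcomm D1 A1) (D1 *m B - B *m D2) (D2 *m C - C *m D1) (mxcomm D2 A2).
Proof.
by rewrite /mxcomm !mulmx_block !mul0mx !mulmx0 !addr0 !add0r opp_block_mx
  add_block_mx.
Qed.

Lemma mxcomm_addl_scalar n (c : K) (A B : 'M[K]_n) :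
  mxcomm (A + c%:M) B = mxcomm A B.
Proof.
by rewrite /mxcomm mulmxDl mulmxDr mul_scalar_mx mul_mx_scalar opprD addrACA
  subrr addr0.
Qed.

Lemma mxcommZr n (c : K) (A B : 'M[K]_n) :
  mxcomm A (c *: B) = c *: mxcomm A B.
Proof. by rewrite /mxcomm -scalemxAr -scalemxAl scalerBr. Qed.

(** Conjugation by the block diagonal matrix of [1] and [P]. The last clause keeps a triangular form
    intact under a change of basis in the second block. *)
Lemma similar_mx_dr n1 n2 (A : 'M[K]_(n1 + n2)) (A2' : 'M[K]_n2) :
  similar_mx (drsubmx A) A2' ->
  exists B C, similar_mx A (block_mx (ulsubmx A) B C A2') /\ (ursubmx A = 0 -> B = 0).
Proof.
move=> [P uP e]; exists (ursubmx A *m invmx P); exists (P *m dlsubmx A).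
split=> [|->]; last by rewrite mul0mx.
exists (block_mx 1%:M 0 0 P).
  by rewrite unitmxE det_ublock det1 mul1r -unitmxE.
rewrite -{1}[A]submxK !mulmx_block !mul0mx !mul1mx !mulmx0 !mulmx1 !addr0 !add0r.
by rewrite e -mulmxA mulVmx // mulmx1.
Qed.

Lemma addmxE m n (A B : 'M[K]_(m, n)) i j : (A + B) i j = A i j + B i j.
Proof. by rewrite mxE. Qed.

Lemma oppmxE m n (A : 'M[K]_(m, n)) i j : (- A) i j = - A i j.
Proof. by rewrite mxE. Qed.

Lemma scalemxE m n c (A : 'M[K]_(m, n)) i j : (c *: A) i j = c * A i j.
Proof. by rewrite mxE. Qed.

Lemma similar_shear n (i j : 'I_n) (x : K) (A : 'M[K]_n) : i != j ->
  similar_mx A ((1%:M + x *: delta_mx i j) *m A *m (1%:M - x *: delta_mx i j)).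
Proof.
move=> nij; have nji : j != i by rewrite eq_sym.
have e : (1%:M - x *: delta_mx i j) *m (1%:M + x *: delta_mx i j) = 1%:M :> 'M[K]_n.
  rewrite mulmxBl mul1mx mulmxDr mulmx1 -scalemxAl -scalemxAr.
  by rewrite mul_delta_mx_0 // !scaler0 addr0 addrK.
have e' := mulmx1C e.
exists (1%:M + x *: delta_mx i j); first by case/mulmx1_unit: e'.
by rewrite -!mulmxA e mulmx1.
Qed.

Lemma shearE n (i j : 'I_n) (x : K) (A : 'M[K]_n) k l :
  ((1%:M + x *: delta_mx i j) *m A *m (1%:M - x *: delta_mx i j)) k l =
  A k l + x * (k == i)%:R * A j l - x * (l == j)%:R * (A k i + x * (k == i)%:R * A j i).
Proof.
have delL (B : 'M[K]_n) a b : (delta_mx i j *m B) a b = (a == i)%:R * B j b.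
  rewrite mxE (bigD1 j) //= mxE eqxx andbT big1 ?addr0 // => c nc.
  by rewrite mxE (negPf nc) andbF mul0r.
have delR (B : 'M[K]_n) a b : (B *m delta_mx i j) a b = (b == j)%:R * B a i.
  rewrite mxE (bigD1 i) //= mxE eqxx /= big1 ?addr0 // => [|c nc].
    by rewrite mulrC.
  by rewrite mxE (negPf nc) /= mulr0.
rewrite mulmxDl mul1mx -scalemxAl mulmxBr mulmx1 -scalemxAr !(addmxE, oppmxE, scalemxE).
by rewrite delR !(addmxE, scalemxE) !delL; ring.
Qed.

Lemma zero_diag_block n1 n2 (A1 : 'M[K]_n1) (A2 : 'M[K]_n2) B C :
  zero_diag A1 -> zero_diag A2 -> zero_diag (block_mx A1 B C A2).
Proof.
by move=> z1 z2 i; case: (split_ordP i) => k ->; rewrite (block_mxEul, block_mxEdr).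
Qed.

Lemma zero_diag_ul n1 n2 (A : 'M[K]_(n1 + n2)) : zero_diag A -> zero_diag (ulsubmx A).
Proof. by move=> z i; rewrite !mxE. Qed.

Lemma zero_diag_dr n1 n2 (A : 'M[K]_(n1 + n2)) : zero_diag A -> zero_diag (drsubmx A).
Proof. by move=> z i; rewrite !mxE. Qed.

Section CharZero.

Hypothesis natK : forall m, (m%:R == 0 :> K) = (m == 0%N).

(** If row [0] has a nonzero entry off the diagonal, one shear clears the corner. Otherwise a shear
    first creates such an entry; this fails only for scalar matrices. *)
Lemma similar_corner0 n (A : 'M[K]_n.+1) : (forall a, A <> a%:M) ->
  exists2 B, similar_mx A B & B 0 0 = 0.
Proof.
have step (B : 'M[K]_n.+1) j : j != 0 -> B 0 j != 0 ->
    exists2 C, similar_mx B C & C 0 0 = 0.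
  move=> nj0 nB; have n0j : (0 == j) = false by rewrite eq_sym (negPf nj0).
  have S := similar_shear (B 0 0 / B 0 j) B nj0; eexists; first exact: S.
  by rewrite shearE eqxx n0j !(mulr0, mul0r, addr0) mulr1 divfK ?subrr.
move=> nA; case: (pickP (fun j => (j != 0) && (A 0 j != 0))) => [j /andP[j1 j2]|A0].
  exact: step j1 j2.
have {}A0 j : j != 0 -> A 0 j = 0.
  by move=> nj; apply/eqP; move: (A0 j); rewrite /= nj => /negPn.
have step2 x j l : j != 0 -> l != 0 ->
    A 0 l + x * A j l - x * (l == j)%:R * (A 0 0 + x * A j 0) != 0 ->
    exists2 C, similar_mx A C & C 0 0 = 0.
  move=> nj nl nz; have nj' : 0 != j by rewrite eq_sym.
  have S := similar_shear x A nj'.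
  have nzB : ((1%:M + x *: delta_mx 0 j) *m A *m (1%:M - x *: delta_mx 0 j)) 0 l != 0.
    by rewrite shearE eqxx !mulr1.
  by have [C SC C0] := step _ l nl nzB; exists C => //; apply: similar_mx_trans S SC.
case: (pickP (fun jl : 'I_n.+1 * 'I_n.+1 =>
   [&& jl.1 != 0, jl.2 != 0, jl.2 != jl.1 & A jl.1 jl.2 != 0])) => [[j l]|Ajl].
  case/and4P => /= nj nl nlj nz; apply: (step2 1 j l) => //.
  by rewrite A0 // (negPf nlj) add0r mul1r mulr0 mul0r subr0.
(* The shears with [x = 1] and [x = -1] produce this entry and the next one. If both vanish, their
   sum [- 2 * A j 0] gives [A j 0 = 0], hence [A j j = A 0 0]. *)
case: (pickP (fun j => (j != 0) && (A j j - A 0 0 - A j 0 != 0))) => [j /andP[nj nz]|d1].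
  apply: (step2 1 j j) => //; rewrite A0 // eqxx mulr1.
  by rewrite [X in X != 0](_ : _ = A j j - A 0 0 - A j 0) //; ring.
case: (pickP (fun j => (j != 0) && (- A j j + A 0 0 - A j 0 != 0))) => [j /andP[nj nz]|d2].
  apply: (step2 (- 1) j j) => //; rewrite A0 // eqxx mulr1.
  by rewrite [X in X != 0](_ : _ = - A j j + A 0 0 - A j 0) //; ring.
case: (nA (A 0 0)); apply/matrixP => i j; rewrite mxE.
have dd l : l != 0 -> A l l = A 0 0 /\ A l 0 = 0.
  move=> nl; have /negbFE/eqP e1 : (A l l - A 0 0 - A l 0 != 0) = false.
    by move: (d1 l); rewrite /= nl.
  have /negbFE/eqP e2 : (- A l l + A 0 0 - A l 0 != 0) = false.
    by move: (d2 l); rewrite /= nl.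
  have A00 : A l 0 = 0.
    apply/eqP; have /eqP : A l 0 *+ 2 = 0.
      rewrite -[RHS]oppr0 -[in RHS](addr0 0) -{1}e1 -e2; ring.
    by rewrite -mulr_natr mulf_eq0 natK orbF.
  by split=> //; apply/eqP; rewrite -subr_eq0 -(subr0 (_ - _)) -{1}A00 e1.
have [->|ni] := eqVneq i 0.
  by have [<-|nj] := eqVneq 0 j; rewrite ?mulr1n // A0 1?eq_sym // mulr0n.
have [<-|nij] := eqVneq i j; first by rewrite (dd i ni).1 mulr1n.
have [->|nj] := eqVneq j 0; first by rewrite (dd i ni).2 mulr0n.
by move: (Ajl (i, j)); rewrite /= ni nj eq_sym nij /= mulr0n => /negbFE/eqP.
Qed.

(** Induction on the size: a scalar matrix of trace zero is zero in characteristic zero; any other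
    matrix gets a zero corner, and its lower right block again has trace zero. *)
Lemma similar_zero_diag n (A : 'M[K]_n) : \tr A = 0 ->
  exists2 Z, similar_mx A Z & zero_diag Z.
Proof.
elim: n A => [|n IH] A trA; first by exists A; [exact: similar_mx_refl | case].
have [/eqP As|nAs] := boolP (A == (A 0 0)%:M).
  exists A; first exact: similar_mx_refl.
  move: trA; rewrite As mxtrace_scalar => /eqP.
  by rewrite -mulr_natr mulf_eq0 natK orbF => /eqP -> i; rewrite mxE mul0rn.
have [|B AB B0] := @similar_corner0 _ A.
  by move=> a Aa; case/eqP: nAs; rewrite Aa mxE eqxx mulr1n.
have trB : \tr (drsubmx (B : 'M_(1 + n))) = 0.
  have := similar_mx_trace AB; rewrite trA.
  have -> : \tr B = \tr (ulsubmx (B : 'M_(1 + n))) + \tr (drsubmx (B : 'M_(1 + n))).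
    by rewrite -(mxtrace_block _ (ursubmx (B : 'M_(1 + n))) (dlsubmx (B : 'M_(1 + n)))) submxK.
  rewrite (_ : \tr (ulsubmx _) = 0) ?add0r //.
  rewrite /mxtrace big_ord1 !mxE -[RHS]B0.
  by congr (B _ _); apply: val_inj.
have [Z2 SZ Z20] := IH _ trB.
have [C [C' [S _]]] := similar_mx_dr SZ.
eexists; first exact: similar_mx_trans AB S.
apply: (@zero_diag_block 1 n) Z20 => k.
by rewrite !mxE -[RHS]B0; congr (B _ _); apply: val_inj; rewrite /= ord1.
Qed.

End CharZero.

End Similarity.

(** * Values of the two-commutator forms and block matrices *)

Section Representation.

Variable K : closedFieldType.

Definition twist n (k : bool) (p q : K) (D U V : 'M[K]_n) : 'M[K]_n :=
  let T := p *: (U *m V) + q *: (V *m U) in if k then mxcomm D T else T.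

(* [k] selects the form [[D, [U, V]]] coming from the standard polynomial; [e] asks in addition
   that [V] be invertible, which is what the block construction needs. *)
Definition rep n (k : bool) (p q : K) (e : bool) (A : 'M[K]_n) : Prop :=
  exists D Y Z, twist k p q D (mxcomm D Y) (mxcomm D Z) = A /\
    (e ==> (mxcomm D Z \in unitmx)).

Lemma rep_weaken n k p q (A : 'M[K]_n) : rep k p q true A -> rep k p q false A.
Proof. by move=> [D [Y [Z [e _]]]]; exists D, Y, Z. Qed.

Lemma rep0 n k p q : rep k p q false (0 : 'M[K]_n).
Proof.
exists 0, 0, 0; split=> //; rewrite /twist /mxcomm.
by case: k; rewrite !(mulmx0, mul0mx, subr0, scaler0, addr0).
Qed.

Lemma rep_similar n k p q e (A B : 'M[K]_n) :
  similar_mx A B -> rep k p q e B -> rep k p q e A.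
Proof.
move=> [P uP /(similar_mxE uP) eA] [D [Y [Z [eB iB]]]].
pose cj X := invmx P *m X *m P; exists (cj D), (cj Y), (cj Z).
have cjM X1 X2 : cj X1 *m cj X2 = cj (X1 *m X2) by rewrite /cj !mulmxA mulmxK.
rewrite !mxcomm_conj // -!/(cj _); split; last first.
  by apply/implyP=> /(implyP iB) u; rewrite /cj !unitmx_mul unitmx_inv uP u.
rewrite eA -eB /twist !cjM.
have cjD X1 X2 : p *: cj X1 + q *: cj X2 = cj (p *: X1 + q *: X2).
  by rewrite /cj mulmxDr mulmxDl -!scalemxAr -!scalemxAl.
rewrite cjD.
by case: k {eB} => //; rewrite mxcomm_conj.
Qed.

(** The map is singular only when [c] is an eigenvalue of [- M]. The bad values are packaged as
    roots of a polynomial so that several such conditions can be met at once. *)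
Lemma generic_surj m n (L : 'M[K]_(m, n) -> 'M[K]_(m, n)) M :
  (forall X, mxvec (L X) = mxvec X *m M) ->
  exists2 r : {poly K}, r != 0 &
    forall c, ~~ root r c -> forall B, exists X, c *: X + L X = B.
Proof.
move=> LM; exists (char_poly (- M)); first exact/monic_neq0/char_poly_monic.
move=> c; rewrite -eigenvalue_root_char negbK => /eqP ker0 B.
have uM : - M - c%:M \in unitmx by rewrite -row_free_unit -kermx_eq0; apply/eqP.
exists (vec_mx (- mxvec B *m invmx (- M - c%:M))).
apply: (can_inj mxvecK); rewrite linearD linearZ /= LM !vec_mxK.
have := mulmxKV uM (- mxvec B); move: (_ *m invmx _) => x ex.
by rewrite -[RHS]opprK -ex mulmxBr mulmxN mul_mx_scalar opprB opprK.
Qed.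

Lemma common_nonroot (rs : seq {poly K}) : all (fun r => r != 0) rs ->
  exists c, all (fun r => ~~ root r c) rs.
Proof.
move=> nz; have : \prod_(r <- rs) r != 0 by rewrite prodf_seq_neq0; apply: sub_all nz.
case/closed_nonrootP => c nr; exists c; apply/allP => r rrs; apply: contra nr.
by rewrite (big_rem r) //= rootM => ->.
Qed.

(* [U] and [V] are rescaled on the first block by inverse factors, and the first block of [D] is
   shifted by a scalar: this leaves the first block of the value unchanged, while for generic
   parameters the linear equations for the off-diagonal blocks become solvable. *)
Lemma rep_block n1 n2 k p q e (A1 : 'M[K]_n1) (A2 : 'M[K]_n2) B C :
  p != 0 -> (q != 0) || e -> rep k p q true A1 -> rep k p q e A2 ->
  rep k p q e (block_mx A1 B C A2).
Proof.
move=> p0 qe [D1 [Y1 [Z1 [e1 /= u1]]]] [D2 [Y2 [Z2 [e2 u2]]]].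
set V1 := mxcomm D1 Z1 in e1 u1; set V2 := mxcomm D2 Z2 in e2 u2.
(* For block diagonal [V] the off-diagonal blocks of [p U V + q V U] are linear in those of [U].
   Multiplying by the inverse of [q V1] on the left, or of [p V1] on the right, gives the shape
   [s X + L X]. *)
have [s s0 [sur12 sur21]] : exists2 s, s != 0 &
   (forall X', exists X : 'M_(n1, n2), p *: (X *m V2) + q *: (s *: V1 *m X) = X') /\
   (forall X', exists X : 'M_(n2, n1), p *: (X *m (s *: V1)) + q *: (V2 *m X) = X').
  clearbody V1 V2.
  have [X|r1 r10 h1] := @generic_surj n1 n2 (fun X => (p / q) *: (invmx V1 *m X *m V2))
    ((p / q) *: (lin_mulmx (invmx V1) *m lin_mulmxr V2)).
    by rewrite linearZ /= -scalemxAr mulmxA !mul_vec_lin.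
  have [X|r2 r20 h2] := @generic_surj n2 n1 (fun X => (q / p) *: (V2 *m X *m invmx V1))
    ((q / p) *: (lin_mulmx V2 *m lin_mulmxr (invmx V1))).
    by rewrite linearZ /= -scalemxAr mulmxA !mul_vec_lin.
  have [|s /and4P[s0 s1 s2 _]] := @common_nonroot [:: 'X; r1; r2].
    by rewrite /= polyX_eq0 r10 r20.
  rewrite rootX in s0; exists s => //; split=> X'.
    (* Here [p / q] is the default [0], so the equation is solved directly: [e] holds and [V2] is
       invertible. *)
    have [q0|q0] := eqVneq q 0.
      move: qe; rewrite q0 eqxx /= => ee; rewrite ee /= in u2.
      exists (p^-1 *: (X' *m invmx V2)).
      by rewrite scale0r addr0 -scalemxAl mulmxKV // scalerA divff // scale1r.
    have [X eX] := h1 _ s1 (q^-1 *: (invmx V1 *m X')).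
    exists X; have := congr1 (fun M => q *: (V1 *m M)) eX.
    rewrite -scalemxAr scalerA divff // scale1r mulKVmx // => <-.
    rewrite mulmxDr -!scalemxAr -!scalemxAl !mulmxA mulmxV // mul1mx addrC scalerDr.
    by rewrite [q *: ((p / q) *: _)]scalerA mulrCA divff // mulr1.
  have [X eX] := h2 _ s2 (p^-1 *: (X' *m invmx V1)).
  exists X; have := congr1 (fun M => p *: (M *m V1)) eX.
  rewrite -scalemxAl scalerA divff // scale1r mulmxKV // => <-.
  rewrite mulmxDl -!scalemxAr -!scalemxAl mulmxKV // scalerDr.
  by rewrite [p *: ((q / p) *: _)]scalerA mulrCA divff // mulr1.
(* These Sylvester equations are solvable for generic [c], and the shift of [D1] changes no
   commutator inside the first block. *)
have [c [cur12 cur21]] : exists c,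
   (forall X', exists X : 'M_(n1, n2), (D1 + c%:M) *m X - X *m D2 = X') /\
   (forall X', exists X : 'M_(n2, n1), D2 *m X - X *m (D1 + c%:M) = X').
  have [X|r1 r10 h1] := @generic_surj n1 n2 (fun X => D1 *m X - X *m D2)
    (lin_mulmx D1 - lin_mulmxr D2).
    by rewrite linearB /= mulmxBr !mul_vec_lin.
  have [X|r2 r20 h2] := @generic_surj n2 n1 (fun X => X *m D1 - D2 *m X)
    (lin_mulmxr D1 - lin_mulmx D2).
    by rewrite linearB /= mulmxBr !mul_vec_lin.
  have [|c /and3P[c1 c2 _]] := @common_nonroot [:: r1; r2]; first by rewrite /= r10 r20.
  exists c; split=> X'.
    by have [X <-] := h1 c c1 X'; exists X; rewrite mulmxDl mul_scalar_mx addrAC addrC.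
  have [X eX] := h2 c c2 (- X'); exists X; rewrite -[RHS]opprK -eX mulmxDr mul_mx_scalar.
  by rewrite addrA opprB [c *: X + _]addrC.
(* On the off-diagonal blocks the outer bracket with [D] is undone first (if [k]), then [U] is
   found, then [Y]. *)
have [T12 eT12] : exists X : 'M_(n1, n2),
    (if k then (D1 + c%:M) *m X - X *m D2 else X) = B by case: k {e1 e2}; eauto.
have [T21 eT21] : exists X : 'M_(n2, n1),
    (if k then D2 *m X - X *m (D1 + c%:M) else X) = C by case: k {e1 e2 eT12}; eauto.
have [U12 eU12] := sur12 T12; have [U21 eU21] := sur21 T21.
have [Y12 eY12] := cur12 U12; have [Y21 eY21] := cur21 U21.
exists (block_mx (D1 + c%:M) 0 0 D2), (block_mx (s^-1 *: Y1) Y12 Y21 Y2),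
  (block_mx (s *: Z1) 0 0 Z2).
rewrite !mxcomm_block !mxcomm_addl_scalar !mxcommZr !mulmx0 !mul0mx !subr0.
rewrite -/V1 -/V2 eY12 eY21; split; last first.
  apply/implyP => ee; rewrite ee /= in u2.
  rewrite unitmxE det_ublock unitrM -!unitmxE u2 andbT.
  by rewrite unitmxZ ?unitfE.
rewrite /twist !mulmx_block !mulmx0 !mul0mx !addr0 !add0r !scale_block_mx add_block_mx.
have sc1 X1 X2 : s^-1 *: X1 *m (s *: X2) = X1 *m X2 :> 'M_n1.
  by rewrite -scalemxAl -scalemxAr scalerA mulVf // scale1r.
have sc2 X1 X2 : s *: X1 *m (s^-1 *: X2) = X1 *m X2 :> 'M_n1.
  by rewrite -scalemxAl -scalemxAr scalerA divff // scale1r.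
rewrite eU12 eU21 sc1 sc2.
move: e1 e2 eT12 eT21; rewrite /twist; case: k => [<- <- <- <-|<- <- <- <-] //.
by rewrite mxcomm_block mxcomm_addl_scalar.
Qed.

End Representation.

(** * Explicit small matrices *)

Section ExplicitMatrices.

Variable K : fieldType.

(** Matrices as lists of rows: sums and products compute to lists again, so an identity of explicit
    matrices becomes one [ring] or [field] goal per entry. *)
Definition mxl m n (s : seq (seq K)) : 'M[K]_(m, n) :=
  \matrix_(i, j) nth 0 (nth [::] s i) j.

Definition mxl_entry (s : seq (seq K)) i j : K := nth 0 (nth [::] s i) j.

Definition mxl_of m n (f : nat -> nat -> K) := mkseq (fun i => mkseq (f i) n) m.

Lemma mxl_ofE m n f : mxl m n (mxl_of m n f) = \matrix_(i, j) f i j.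
Proof. by apply/matrixP => i j; rewrite !mxE !nth_mkseq. Qed.

Lemma mxlM m n p s t : mxl m n s *m mxl n p t = mxl m p (mxl_of m p (fun i j =>
  foldr (fun k a => mxl_entry s i k * mxl_entry t k j + a) 0 (iota 0 n))).
Proof.
apply/matrixP => i j; rewrite mxl_ofE !mxE.
transitivity (\sum_(0 <= k < n) mxl_entry s i k * mxl_entry t k j).
  by rewrite big_mkord; apply: eq_bigr => k _; rewrite !mxE.
by rewrite unlock /index_iota subn0.
Qed.

Lemma mxlD m n s t :
  mxl m n s + mxl m n t = mxl m n (mxl_of m n (fun i j => mxl_entry s i j + mxl_entry t i j)).
Proof. by rewrite mxl_ofE; apply/matrixP => i j; rewrite !mxE. Qed.

Lemma mxlN m n s : - mxl m n s = mxl m n (mxl_of m n (fun i j => - mxl_entry s i j)).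
Proof. by rewrite mxl_ofE; apply/matrixP => i j; rewrite !mxE. Qed.

Lemma mxlZ m n c s : c *: mxl m n s = mxl m n (mxl_of m n (fun i j => c * mxl_entry s i j)).
Proof. by rewrite mxl_ofE; apply/matrixP => i j; rewrite !mxE. Qed.

Lemma mxl1 n : 1%:M = mxl n n (mxl_of n n (fun i j => (i == j)%:R)).
Proof. by rewrite mxl_ofE; apply/matrixP => i j; rewrite !mxE. Qed.

End ExplicitMatrices.

Arguments mxl {K}.

Ltac mx_cases := apply/matrixP;
  case=> [[|[|[|[|[|?]]]]] ?] //; case=> [[|[|[|[|[|?]]]]] ?] //; rewrite !mxE /=.

Ltac mx_entries := rewrite ?(mxlM, mxlN, mxlD, mxlZ, mxl1); congr mxl;
  rewrite /mxl_of /mxl_entry /mkseq /=; repeat (congr cons).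

(** * Diagonal commutators, blocks of size two, triangular forms *)

Section SmallMatrices.

Variable K : closedFieldType.
Hypothesis natK : forall m, (m%:R == 0 :> K) = (m == 0%N).

Lemma similar_by n (P Q A B : 'M[K]_n) :
  P *m Q = 1%:M -> P *m A = B *m P -> similar_mx A B.
Proof. by case/mulmx1_unit => uP _ e; exists P. Qed.

Lemma block_mx_eq m1 m2 n1 n2 (A : 'M[K]_(m1 + m2, n1 + n2)) Aul Aur Adl Adr :
  ulsubmx A = Aul -> ursubmx A = Aur -> dlsubmx A = Adl -> drsubmx A = Adr ->
  A = block_mx Aul Aur Adl Adr.
Proof. by move=> <- <- <- <-; rewrite submxK. Qed.

Lemma mx1E (A : 'M[K]_1) : exists x, A = mxl 1 1 [:: [:: x]].
Proof. by exists (A 0 0); apply/matrixP=> i j; rewrite !ord1 mxE. Qed.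

Lemma mx2E (A : 'M[K]_2) : exists x11 x12 x21 x22,
  A = mxl 2 2 [:: [:: x11; x12]; [:: x21; x22]].
Proof.
pose f i j := A (inord i) (inord j).
exists (f 0 0)%N, (f 0 1)%N, (f 1 0)%N, (f 1 1)%N; apply/matrixP; rewrite /f.
by case=> [[|[|?]] ?] //; case=> [[|[|?]] ?] //; rewrite mxE; congr (A _ _);
  apply: val_inj; rewrite /= inordK.
Qed.

Lemma mx3E (A : 'M[K]_3) : exists x11 x12 x13 x21 x22 x23 x31 x32 x33,
  A = mxl 3 3 [:: [:: x11; x12; x13]; [:: x21; x22; x23]; [:: x31; x32; x33]].
Proof.
pose f i j := A (inord i) (inord j).
exists (f 0 0)%N, (f 0 1)%N, (f 0 2)%N, (f 1 0)%N, (f 1 1)%N, (f 1 2)%N, (f 2 0)%N,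
  (f 2 1)%N, (f 2 2)%N.
apply/matrixP; rewrite /f.
by case=> [[|[|[|?]]] ?] //; case=> [[|[|[|?]]] ?] //; rewrite mxE; congr (A _ _);
  apply: val_inj; rewrite /= inordK.
Qed.

(** The entries [0, ..., n - 1] are distinct in characteristic zero, so the commutators with this
    matrix are exactly the zero-diagonal matrices. *)
Definition diag_nat n : 'M[K]_n := diag_mx (\row_i (i : nat)%:R).

Lemma natrB_neq0 m n : m != n -> (m%:R - n%:R : K) != 0.
Proof.
move=> ne; wlog lt_mn : m n ne / (m < n)%N.
  move=> W; case: (ltngtP m n) => [lt|lt|e]; first exact: W.
    by rewrite -opprB oppr_eq0 W // eq_sym.
  by rewrite e eqxx in ne.
by rewrite -opprB -natrB 1?ltnW // oppr_eq0 natK subn_eq0 -ltnNge.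
Qed.

Lemma mxcomm_diag_nat n (Y : 'M[K]_n) i j :
  mxcomm (diag_nat n) Y i j = ((i : nat)%:R - (j : nat)%:R) * Y i j.
Proof. by rewrite /mxcomm addmxE oppmxE mul_diag_mx mul_mx_diag !mxE; ring. Qed.

Lemma zero_diag_mxcomm n (U : 'M[K]_n) : zero_diag U ->
  exists Y, mxcomm (diag_nat n) Y = U.
Proof.
move=> U0; exists (\matrix_(i, j) (U i j / ((i : nat)%:R - (j : nat)%:R))).
apply/matrixP => i j; rewrite mxcomm_diag_nat mxE mulrC.
have [->|ne] := eqVneq i j; first by rewrite subrr mulr0 U0.
by rewrite divfK // natrB_neq0.
Qed.

(** Products of zero-diagonal matrices of size two are diagonal, so [D] is not taken diagonal here.
    Instead [D = A] unless [A = 0], and [V = diag(1, -1)] anticommutes with [U], so the value is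
    [(q - p) V U], a multiple of [D]. *)
Lemma rep2 p q (A : 'M[K]_2) : p != q -> zero_diag A -> rep false p q true A.
Proof.
move=> pq; have qp0 : q - p != 0 by rewrite subr_eq0 eq_sym.
have [x11 [x [y [x22 ->]]]] := mx2E A => z0.
have {z0} [-> ->] : x11 = 0 /\ x22 = 0.
  by split; [have := z0 0 | have := z0 1]; rewrite mxE.
(* The pair [(d, e)] is [(x, y)], or [(1, 0)] when [A = 0]; [(s, t)] completes it to determinant
   one, which makes [[D, Z] = diag(1, -1)]. *)
have [d [e [s [t [xe dy de]]]]] : exists d e s t, [/\ x * e = d * y, d * t - s * e = 1
   & (x = d /\ y = e) \/ (x = 0 /\ y = 0)].
  have [->|x0] := eqVneq x 0; last first.
    by exists x, y, 0, x^-1; split; [ring | rewrite divff // mul0r subr0 | left].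
  have [->|y0] := eqVneq y 0.
    by exists 1, 0, 0, 1; split; [ring | ring | right].
  by exists 0, y, (- y^-1), 0; split; [ring | rewrite mul0r mulNr mulVf // opprK add0r | left].
pose D := mxl 2 2 [:: [:: 0; d]; [:: e; 0]].
pose c := if (x == 0) && (y == 0) then 0 else (q - p)^-1.
pose Y := mxl 2 2 [:: [:: 0; 0]; [:: 0; c]].
pose Z := mxl 2 2 [:: [:: 0; s]; [:: t; 0]].
exists D, Y, Z.
have eV : mxcomm D Z = mxl 2 2 [:: [:: 1; 0]; [:: 0; -1]].
  by rewrite /mxcomm /D /Z; mx_entries; rewrite -?dy; ring.
have eU : mxcomm D Y = mxl 2 2 [:: [:: 0; c * d]; [:: - c * e; 0]].
  by rewrite /mxcomm /D /Y; mx_entries; ring.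
rewrite eU eV; split; last first.
  suff /mulmx1_unit[] : mxl 2 2 [:: [:: 1; 0]; [:: 0; -1]] *m mxl 2 2 [:: [:: 1; 0]; [:: 0; -1]]
    = 1%:M :> 'M[K]_2 by [].
  by mx_entries; ring.
have cx : (q - p) * (c * d) = x.
  rewrite /c; case: de => [[-> ->]|[-> ->]]; last by rewrite eqxx !(mul0r, mulr0).
  have [->|d0] := eqVneq d 0; first by rewrite !mulr0.
  by rewrite mulrA divff ?mul1r.
have cy : (q - p) * (c * e) = y.
  rewrite /c; case: de => [[-> ->]|[-> ->]]; last by rewrite eqxx !(mul0r, mulr0).
  have [->|e0] := eqVneq e 0; first by rewrite !mulr0.
  by rewrite andbF mulrA divff ?mul1r.
by rewrite /twist -cx -cy; mx_entries; ring.
Qed.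

(** A left eigenvector is completed to a basis of row vectors. *)
Lemma eigen_block n (A : 'M[K]_(1 + n)) : exists a C A2,
  similar_mx A (block_mx a%:M 0 C A2).
Proof.
have [|a] := closed_rootP (char_poly A) _; first by rewrite size_char_poly.
rewrite -eigenvalue_root_char => /eigenvalueP[v vA v0].
pose f : 'M[K]_(1 + n) := delta_mx 0 0 *m v.
have ef : delta_mx 0 0 *m f = v by rewrite mulmxA mul_delta_mx (_ : delta_mx 0 0 = 1%:M)
  ?mul1mx //; apply/matrixP=> i j; rewrite !ord1 !mxE.
have [|g ug eg] := @complete_unitmx _ 1 _ (delta_mx 0 0) f.
  by rewrite ef mxrank_delta rank_rV v0.
pose B : 'M[K]_(1 + n) := g *m A *m invmx g.
have rB : delta_mx (0 : 'I_1) 0 *m B = a *: delta_mx 0 0.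
  by rewrite /B !mulmxA -eg ef vA -scalemxAl -ef eg mulmxK.
have eB : g *m A = B *m g by rewrite /B mulmxKV.
clearbody B; exists a, (dlsubmx B), (drsubmx B); exists g => //.
rewrite eB; congr (_ *m _).
rewrite -[LHS]submxK; congr block_mx; apply/matrixP=> i j; rewrite !ord1 !mxE.
  have := congr1 (fun M : 'rV_(1 + n) => M 0 (lshift n 0)) rB.
  rewrite -rowE !mxE (_ : lshift n 0 = 0) //; last exact: val_inj.
  by rewrite eqxx mulr1 => ->.
have := congr1 (fun M : 'rV_(1 + n) => M 0 (rshift 1 j)) rB.
rewrite -rowE !mxE /= mulr0 => e; rewrite -[RHS]e.
by congr (B _ _); apply: val_inj.
Qed.

Lemma triangular3 (A : 'M[K]_3) : exists a b c x y z,
  similar_mx A (mxl 3 3 [:: [:: a; 0; 0]; [:: x; b; 0]; [:: z; y; c]]).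
Proof.
have [a [C [A2 S1]]] := eigen_block (A : 'M_(1 + 2)).
have [b [C' [A3 S2]]] := eigen_block (A2 : 'M_(1 + 1)).
have := @similar_mx_dr _ 1 2 (block_mx a%:M 0 C A2) (block_mx b%:M 0 C' A3).
rewrite block_mxKdr block_mxKul block_mxKur => /(_ S2) [B [C'' [S3 /(_ erefl) B0]]].
rewrite {}B0 in S3.
have [z1 [z2 eC]] : exists z1 z2, C'' = mxl 2 1 [:: [:: z1]; [:: z2]].
  exists (C'' 0 0), (C'' 1 0); apply/matrixP; case=> [[|[|?]] ?] // j; rewrite ord1 mxE //;
  by congr (C'' _ _); apply: val_inj.
have [y eC'] := mx1E C'; have [c eA3] := mx1E A3.
exists a, b, c, z1, y, z2; set M := mxl 3 3 _.
suff -> : M = block_mx a%:M 0 C'' (block_mx b%:M 0 C' A3).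
  exact: similar_mx_trans S1 S3.
rewrite /M eC eC' eA3; apply: (@block_mx_eq 1 2 1 2); try by mx_cases.
by apply: (@block_mx_eq 1 1 1 1); mx_cases.
Qed.

End SmallMatrices.

(** * Blocks of size three *)

Section ThreeByThree.

Variable K : closedFieldType.
Hypothesis natK : forall m, (m%:R == 0 :> K) = (m == 0%N).

(** From the triangular form, a shear removes the corner [z] by means of [c - a], [x] or [y],
    whichever is nonzero. If all three vanish, exchanging the first two basis vectors moves [z] next
    to the diagonal. *)
Lemma similar_bidiagonal3 (A : 'M[K]_3) : exists a b c x y,
  similar_mx A (mxl 3 3 [:: [:: a; 0; 0]; [:: x; b; 0]; [:: 0; y; c]]).
Proof.
have [a [b [c [x [y [z S]]]]]] := triangular3 A.
have [ac|ac] := eqVneq a c; last first.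
  have ca : c - a != 0 by rewrite subr_eq0 eq_sym.
  pose t := z / (c - a); exists a, b, c, x, y; apply: similar_mx_trans S _.
  apply: (@similar_by _ _ (mxl 3 3 [:: [:: 1; 0; 0]; [:: 0; 1; 0]; [:: t; 0; 1]])
                          (mxl 3 3 [:: [:: 1; 0; 0]; [:: 0; 1; 0]; [:: - t; 0; 1]])).
    by mx_entries; ring.
  by rewrite /t; mx_entries; field.
subst c; have [x0|x0] := eqVneq x 0; last first.
  pose t := - z / x; exists a, b, a, x, (y + t * b - a * t); apply: similar_mx_trans S _.
  apply: (@similar_by _ _ (mxl 3 3 [:: [:: 1; 0; 0]; [:: 0; 1; 0]; [:: 0; t; 1]])
                          (mxl 3 3 [:: [:: 1; 0; 0]; [:: 0; 1; 0]; [:: 0; - t; 1]])).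
    by mx_entries; ring.
  by rewrite /t; mx_entries; field.
have [y0|y0] := eqVneq y 0; last first.
  pose t := z / y; exists a, b, a, (x + t * a - b * t), y; apply: similar_mx_trans S _.
  apply: (@similar_by _ _ (mxl 3 3 [:: [:: 1; 0; 0]; [:: t; 1; 0]; [:: 0; 0; 1]])
                          (mxl 3 3 [:: [:: 1; 0; 0]; [:: - t; 1; 0]; [:: 0; 0; 1]])).
    by mx_entries; ring.
  by rewrite /t; mx_entries; field.
exists b, a, a, 0, z; apply: similar_mx_trans S _; rewrite x0 y0.
apply: (@similar_by _ _ (mxl 3 3 [:: [:: 0; 1; 0]; [:: 1; 0; 0]; [:: 0; 0; 1]])
                        (mxl 3 3 [:: [:: 0; 1; 0]; [:: 1; 0; 0]; [:: 0; 0; 1]])).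
  by mx_entries; ring.
by mx_entries; ring.
Qed.

Lemma rep_diag_nat n k p q (U V : 'M[K]_n) : zero_diag U -> zero_diag V -> V \in unitmx ->
  rep k p q true (twist k p q (diag_nat K n) U V).
Proof.
move=> /(zero_diag_mxcomm natK)[Y <-] /(zero_diag_mxcomm natK)[Z <-] uV.
by exists (diag_nat K n), Y, Z.
Qed.

(** For the cyclic permutation [V] the equation splits along cyclic diagonals into circulant systems
    [p w_i + q w_{i+1} = a_i] of determinant [p^3 + q^3], solved by [u]. The bidiagonal form
    vanishes on the cyclic diagonal that corresponds to the zero diagonal of [U]. *)
Lemma rep3 p q (A : 'M[K]_3) : p ^+ 3 + q ^+ 3 != 0 -> rep false p q true A.
Proof.
move=> pq0; have [a [b [c [x [y S]]]]] := similar_bidiagonal3 A.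
apply: rep_similar S _.
pose V := mxl 3 3 [:: [:: 0; 1; 0]; [:: 0; 0; 1]; [:: 1; 0; 0 : K]].
pose u a1 a2 a3 := (q ^+ 2 * a1 - p * q * a2 + p ^+ 2 * a3) / (p ^+ 3 + q ^+ 3).
pose U := mxl 3 3 [:: [:: 0; u y x 0; u c b a]; [:: u a c b; 0; u 0 y x];
                      [:: u x 0 y; u b a c; 0]].
have eA : twist false p q (diag_nat K 3) U V =
    mxl 3 3 [:: [:: a; 0; 0]; [:: x; b; 0]; [:: 0; y; c]].
  by rewrite /twist /U /V /u; mx_entries; field.
rewrite -eA; apply: rep_diag_nat.
- by case=> [[|[|[|?]]] ?]; rewrite // mxE.
- by case=> [[|[|[|?]]] ?]; rewrite // mxE.
have /mulmx1_unit[] // : V *m mxl 3 3 [:: [:: 0; 0; 1]; [:: 1; 0; 0]; [:: 0; 1; 0]] = 1%:M.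
by rewrite /V; mx_entries; ring.
Qed.

(* Zero-diagonal 3x3 matrices, read as a pair of vectors of K^3: then the off-diagonal part of the
   commutator of two of them is a pair of cross products. *)
Definition zd3 (a1 a2 a3 b1 b2 b3 : K) : 'M[K]_3 :=
  mxl 3 3 [:: [:: 0; a3; b3]; [:: b1; 0; a2]; [:: a1; b2; 0]].

Lemma zd3E (A : 'M[K]_3) : zero_diag A ->
  exists a1 a2 a3 b1 b2 b3, A = zd3 a1 a2 a3 b1 b2 b3.
Proof.
have [x11 [x12 [x13 [x21 [x22 [x23 [x31 [x32 [x33 ->]]]]]]]]] := mx3E A => z0.
exists x31, x23, x12, x21, x32, x13; rewrite /zd3.
have := z0 0; have := z0 1; have := z0 (lift 0 1); rewrite !mxE /= => -> -> -> //.
Qed.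

Definition cross_solvable (a1 a2 a3 v1 v2 v3 : K) := exists u1 u2 u3,
  [/\ a1 = u2 * v3 - u3 * v2, a2 = u3 * v1 - u1 * v3 & a3 = u1 * v2 - u2 * v1].

(** The witness [u] is normalized to have coordinate zero at a position where [v] is nonzero. *)
Lemma cross_solvableP a1 a2 a3 v1 v2 v3 : [|| v1 != 0, v2 != 0 | v3 != 0] ->
  a1 * v1 + a2 * v2 + a3 * v3 = 0 -> cross_solvable a1 a2 a3 v1 v2 v3.
Proof.
move=> nz e; case/or3P: nz => nz.
- exists 0, (- a3 / v1), (a2 / v1); split; [|by field|by field].
  by apply: (mulIf nz); rewrite -[LHS]subr0 -e; field.
- exists (a3 / v2), 0, (- a1 / v2); split; [by field| |by field].
  by apply: (mulIf nz); rewrite -[LHS]subr0 -e; field.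
exists (- a2 / v3), (a1 / v3), 0; split; [by field|by field|].
by apply: (mulIf nz); rewrite -[LHS]subr0 -e; field.
Qed.

Lemma orthogonal_nz a1 a2 a3 : exists v1 v2 v3 : K,
  [|| v1 != 0, v2 != 0 | v3 != 0] /\ a1 * v1 + a2 * v2 + a3 * v3 = 0.
Proof.
have [->|nz] := eqVneq a1 0.
  by exists 1, 0, 0; rewrite oner_eq0; split=> //; ring.
by exists a2, (- a1), 0; rewrite oppr_eq0 nz orbT; split=> //; ring.
Qed.

Definition single_coord (a1 a2 a3 : K) := ((a1 != 0)%R + (a2 != 0)%R + (a3 != 0)%R == 1)%N.

(** A vector with exactly one nonzero coordinate is excluded because it would force that coordinate
    of [v] to vanish. *)
Lemma orthogonal_full a1 a2 a3 : ~~ single_coord a1 a2 a3 ->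
  exists v1 v2 v3 : K, [&& v1 != 0, v2 != 0 & v3 != 0] /\ a1 * v1 + a2 * v2 + a3 * v3 = 0.
Proof.
have nz1 : (1 : K) != 0 by rewrite oner_eq0.
have nz2 : (2 : K) != 0 by rewrite natK.
rewrite /single_coord; have [->|n1] := eqVneq a1 0; have [->|n2] := eqVneq a2 0;
  have [->|n3] := eqVneq a3 0 => //= _.
- by exists 1, 1, 1; rewrite nz1; split=> //; ring.
- exists 1, a3, (- a2); rewrite oppr_eq0 n2 n3 nz1; split=> //; ring.
- exists a3, 1, (- a1); rewrite oppr_eq0 n1 n3 nz1; split=> //; ring.
- exists a2, (- a1), 1; rewrite oppr_eq0 n2 n1 nz1; split=> //; ring.
exists (a2 * a3), (a1 * a3), (- 2 * a1 * a2).
rewrite !mulf_eq0 oppr_eq0 (negPf n1) (negPf n2) (negPf n3) (negPf nz2); split=> //; ring.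
Qed.

(** It suffices to find nonzero [v] and [w] orthogonal to the two rescaled vectors with
    [det V = v1 v2 v3 + w1 w2 w3] nonzero. One of them can be chosen with no zero coordinate, and
    scaling it makes the determinant nonzero. *)
Lemma rep_zd3 a1 a2 a3 b1 b2 b3 :
  ~~ (single_coord a1 a2 a3 && single_coord b1 b2 b3) ->
  rep true 1 (-1) true (zd3 a1 a2 a3 b1 b2 b3).
Proof.
have nz2 : (2 : K) != 0 by rewrite natK.
have nz7 : (7 : K) != 0 by rewrite natK.
(* For [D = diag(0, 1, 2)], [ad_D] multiplies entry [(i, j)] by [i - j]; the vectors are divided by
   these factors. *)
have core v1 v2 v3 w1 w2 w3 :
    cross_solvable (a1 / 2) (- a2) (- a3) v1 v2 v3 -> cross_solvable b1 b2 (- b3 / 2) w1 w2 w3 ->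
    v1 * v2 * v3 + w1 * w2 * w3 != 0 -> rep true 1 (-1) true (zd3 a1 a2 a3 b1 b2 b3).
  move=> [u1 [u2 [u3 [e1 e2 e3]]]] [t1 [t2 [t3 [f1 f2 f3]]]] dV.
  pose zdx x1 x2 x3 y1 y2 y3 := mxl 3 3 [:: [:: 0; y1; x1]; [:: x3; 0; y2]; [:: y3; x2; 0 : K]].
  pose U := zdx u1 u2 u3 t1 t2 t3; pose V := zdx v1 v2 v3 w1 w2 w3.
  have -> : zd3 a1 a2 a3 b1 b2 b3 = twist true 1 (-1) (diag_nat K 3) U V.
    have {e1} e1 : a1 = 2 * (u2 * v3 - u3 * v2) by rewrite -e1; field.
    have {e2} e2 : a2 = - (u3 * v1 - u1 * v3) by rewrite -e2 opprK.
    have {e3} e3 : a3 = - (u1 * v2 - u2 * v1) by rewrite -e3 opprK.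
    have {f3} f3 : b3 = - 2 * (t1 * w2 - t2 * w1) by rewrite -f3; field.
    rewrite e1 e2 e3 f1 f2 f3 /twist; apply/matrixP => i j; rewrite mxcomm_diag_nat.
    move: i j; case=> [[|[|[|?]]] ?] //; case=> [[|[|[|?]]] ?] //;
    by repeat (rewrite !mxE || rewrite !big_ord_recl || rewrite !big_ord0 || rewrite /bump /=);
      ring.
  apply: rep_diag_nat.
  - by case=> [[|[|[|?]]] ?]; rewrite // mxE.
  - by case=> [[|[|[|?]]] ?]; rewrite // mxE.
  pose W := (v1 * v2 * v3 + w1 * w2 * w3)^-1 *: mxl 3 3
    [:: [:: - w2 * v2; v1 * v2; w1 * w2]; [:: w2 * w3; - v1 * w3; v1 * v3];
        [:: v3 * v2; w1 * w3; - w1 * v3]].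
  have /mulmx1_unit[] // : V *m W = 1%:M.
  by rewrite /V /W /zdx -scalemxAr; mx_entries; field.
have key v1 v2 v3 w1 w2 w3 : [&& v1 != 0, v2 != 0 & v3 != 0] ->
    exists s : K, [&& s * v1 != 0, s * v2 != 0 & s * v3 != 0] /\
      (s * v1) * (s * v2) * (s * v3) + w1 * w2 * w3 != 0.
  (* Doubling [v] multiplies [v1 v2 v3] by [8], so a vanishing determinant becomes [7 v1 v2 v3]. *)
  move=> nz; have [e|ne] := eqVneq (v1 * v2 * v3 + w1 * w2 * w3) 0; last first.
    by exists 1; rewrite !mul1r.
  case/and3P: nz => n1 n2 n3; exists 2; split; first by rewrite !mulf_neq0.
  have -> : 2 * v1 * (2 * v2) * (2 * v3) + w1 * w2 * w3 = 7 * v1 * v2 * v3.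
    by rewrite -[LHS]subr0 -e; ring.
  by rewrite !mulf_neq0.
rewrite negb_and => /orP[] ns.
  have {ns} : ~~ single_coord (a1 / 2) (- a2) (- a3).
    by rewrite /single_coord !oppr_eq0 mulf_eq0 invr_eq0 (negPf nz2) orbF.
  case/orthogonal_full => v1 [v2 [v3 [nv ev]]].
  have [w1 [w2 [w3 [nw ew]]]] := orthogonal_nz b1 b2 (- b3 / 2).
  have [s [nsv d]] := key _ _ _ w1 w2 w3 nv.
  apply: core d; apply: cross_solvableP => //; first by case/and3P: nsv => ->.
  by rewrite -[RHS](mulr0 s) -ev; ring.
have {ns} : ~~ single_coord b1 b2 (- b3 / 2).
  by rewrite /single_coord mulf_eq0 oppr_eq0 invr_eq0 (negPf nz2) orbF.
case/orthogonal_full => v1 [v2 [v3 [nv ev]]].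
have [w1 [w2 [w3 [nw ew]]]] := orthogonal_nz (a1 / 2) (- a2) (- a3).
have [s [nsv d]] := key _ _ _ w1 w2 w3 nv; rewrite addrC in d.
apply: core d; apply: cross_solvableP => //; first by case/and3P: nsv => ->.
by rewrite -[RHS](mulr0 s) -ev; ring.
Qed.

Lemma zd3_rotate a1 a2 a3 b1 b2 b3 :
  similar_mx (zd3 a1 a2 a3 b1 b2 b3) (zd3 a3 a1 a2 b2 b3 b1).
Proof.
apply: (@similar_by _ _ (mxl 3 3 [:: [:: 0; 1; 0]; [:: 0; 0; 1]; [:: 1; 0; 0]])
                        (mxl 3 3 [:: [:: 0; 0; 1]; [:: 1; 0; 0]; [:: 0; 1; 0]])).
  by mx_entries; ring.
by rewrite /zd3; mx_entries; ring.
Qed.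

(* If both vectors have a single nonzero coordinate, every solution has V singular; another
   zero-diagonal matrix in the similarity class is used instead. *)
Lemma rep_zd3_axis a3 b1 b2 b3 : a3 != 0 -> single_coord b1 b2 b3 ->
  rep true 1 (-1) true (zd3 0 0 a3 b1 b2 b3).
Proof.
have nz1 : (1 : K) != 0 by rewrite oner_eq0.
move=> n3; rewrite /single_coord.
have [->|m1] := eqVneq b1 0; have [->|m2] := eqVneq b2 0; have [->|m3] := eqVneq b3 0 => //= _.
(* In the first two cases the matrix has rank one and square zero, and the target has second vector
   zero. In the third, the first vector of the target is [(0, 1, 1)], with two nonzero
   coordinates. *)
- have S : similar_mx (zd3 0 0 a3 0 0 b3) (zd3 0 0 1 0 0 0).
    apply: (@similar_by _ _ (mxl 3 3 [:: [:: 1; 0; 0]; [:: 0; a3; b3]; [:: 0; 0; 1]])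
              (mxl 3 3 [:: [:: 1; 0; 0]; [:: 0; a3^-1; - b3 / a3]; [:: 0; 0; 1]])).
      by mx_entries; field.
    by rewrite /zd3; mx_entries; ring.
  by apply: rep_similar S _; apply: rep_zd3; rewrite /single_coord !eqxx andbF.
- have S : similar_mx (zd3 0 0 a3 0 b2 0) (zd3 0 0 a3 0 0 0).
    apply: (@similar_by _ _ (mxl 3 3 [:: [:: 1; 0; 0]; [:: 0; 1; 0]; [:: b2; 0; - a3]])
              (mxl 3 3 [:: [:: 1; 0; 0]; [:: 0; 1; 0]; [:: b2 / a3; 0; - a3^-1]])).
      by mx_entries; field.
    by rewrite /zd3; mx_entries; ring.
  by apply: rep_similar S _; apply: rep_zd3; rewrite /single_coord !eqxx andbF.
have S : similar_mx (zd3 0 0 a3 b1 0 0) (zd3 0 1 1 0 (a3 * b1) 0).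
  apply: (@similar_by _ _ (mxl 3 3 [:: [:: 1; 0; 1]; [:: 0; a3; 0]; [:: a3 * b1; 0; 0]])
            (mxl 3 3 [:: [:: 0; 0; (a3 * b1)^-1]; [:: 0; a3^-1; 0]; [:: 1; 0; - (a3 * b1)^-1]])).
    by mx_entries; field; rewrite ?m1 ?n3.
  by rewrite /zd3; mx_entries; ring.
by apply: rep_similar S _; apply: rep_zd3; rewrite /single_coord !eqxx nz1.
Qed.

(** In the exceptional case, cyclic rotations of the basis bring the nonzero coordinate of the first
    vector to the third place. *)
Lemma rep3_comm (A : 'M[K]_3) : \tr A = 0 -> rep true 1 (-1) true A.
Proof.
case/(similar_zero_diag natK) => Z S /zd3E[a1 [a2 [a3 [b1 [b2 [b3 eZ]]]]]].
apply: rep_similar S _; rewrite {Z}eZ.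
have [/andP[]|] := boolP (single_coord a1 a2 a3 && single_coord b1 b2 b3); last exact: rep_zd3.
rewrite {1}/single_coord.
have [->|n1] := eqVneq a1 0; have [->|n2] := eqVneq a2 0; have [->|n3] := eqVneq a3 0 => //= _ sb.
- exact: rep_zd3_axis.
- apply: rep_similar (zd3_rotate _ _ _ _ _ _) _; apply: rep_zd3_axis => //.
  by move: sb; rewrite /single_coord -addnA addnC.
do 2 apply: rep_similar (zd3_rotate _ _ _ _ _ _) _; apply: rep_zd3_axis => //.
by move: sb; rewrite /single_coord addnC addnA.
Qed.

End ThreeByThree.

(** * Matrices of size five *)

Section FiveByFive.

Variable K : closedFieldType.
Hypothesis natK : forall m, (m%:R == 0 :> K) = (m == 0%N).

Lemma complete_rows m1 m2 (L : 'M[K]_(m1, m1 + m2)) : row_free L ->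
  exists2 P, P \in unitmx & row_mx 1%:M 0 *m P = L.
Proof.
move=> fL; pose E : 'M[K]_(m1, m1 + m2) := row_mx 1%:M 0; pose f := E^T *m L.
have EE : E *m E^T = 1%:M by rewrite tr_row_mx mul_row_col trmx1 trmx0 mulmx1 mulmx0 addr0.
have Ef : E *m f = L by rewrite mulmxA EE mul1mx.
have [|g ug eg] := @complete_unitmx _ _ _ E f; last by exists g; rewrite // -eg.
have fE : row_free E by apply/row_freeP; exists E^T.
by rewrite Ef (eqP fL) (eqP fE).
Qed.

(** In the basis made of the left kernel of [R] followed by the rows of [L], the lower right block
    is [L *m A *m R]. *)
Lemma similar_dr0 m1 m2 (A : 'M[K]_(m1 + m2)) (L : 'M_(m2, m1 + m2)) (R : 'M_(m1 + m2, m2)) :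
  L *m R = 1%:M -> L *m A *m R = 0 -> exists2 B, similar_mx A B & drsubmx B = 0.
Proof.
move=> LR LAR.
have fK : row_free (row_base (kermx R)) by exact: row_base_free.
have rk : \rank (kermx R) = m1.
  rewrite mxrank_ker; suff -> : \rank R = m2 by rewrite addnK.
  apply/eqP; rewrite eqn_leq rank_leq_col -{1}(mxrank1 K m2) -LR.
  exact: mxrankM_maxr.
have [Q fQ QR] : exists2 Q : 'M[K]_(m1, m1 + m2), row_free Q & Q *m R = 0.
  move: fK; have : row_base (kermx R) *m R = 0.
    by apply/eqP; rewrite -sub_kermx eq_row_base.
  by move: (row_base _); rewrite rk => Q; exists Q.
pose P : 'M[K]_(m1 + m2) := col_mx Q L.
have PR : P *m R = col_mx 0 1%:M by rewrite mul_col_mx QR LR.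
have uP : P \in unitmx.
  rewrite -row_free_unit; apply: inj_row_free => x.
  rewrite -[x]hsubmxK /P mul_row_col => e.
  have x2 : rsubmx x = 0.
    have := congr1 (mulmx^~ R) e.
    by rewrite mulmxDl -!mulmxA QR LR mulmx0 add0r mulmx1 mul0mx.
  move: e; rewrite x2 mul0mx addr0 => e.
  by rewrite (row_free_inj fQ (etrans e (esym (mul0mx _ _)))) row_mx0.
exists (P *m A *m invmx P); first by exists P => //; rewrite mulmxKV.
have eR : R = invmx P *m col_mx 0 1%:M by rewrite -PR mulKmx.
have drE (B : 'M[K]_(m1 + m2)) : drsubmx B = row_mx 0 1%:M *m B *m col_mx 0 1%:M.
  by rewrite -{2}[B]submxK mul_row_block mul_row_col !mul0mx !mul1mx !add0r mulmx0 add0r mulmx1.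
rewrite drE -!mulmxA -eR !mulmxA (_ : row_mx 0 1%:M *m P = L) //.
by rewrite mul_row_col mul0mx mul1mx add0r.
Qed.

(** Stack [L] and [L *m A], with [L] the rows [v], [w]: the first two columns of a right inverse
    form an [R] with [L R = 1] and [L A R = 0]. *)
Lemma similar_dr0_rows m1 (A : 'M[K]_(m1 + 2)) (v w : 'rV_(m1 + 2)) :
  (forall x1 x2 x3 x4, x1 *: v + x2 *: w + x3 *: (v *m A) + x4 *: (w *m A) = 0 ->
    [/\ x1 = 0, x2 = 0, x3 = 0 & x4 = 0]) ->
  exists2 B, similar_mx A B & drsubmx B = 0.
Proof.
move=> free; pose L : 'M[K]_(1 + 1, m1 + 2) := col_mx v w.
have : row_free (col_mx L (L *m A)).
  apply: inj_row_free => x; rewrite -[x]hsubmxK mul_row_col.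
  rewrite -[lsubmx x](@hsubmxK _ 1 1 1) -[rsubmx x](@hsubmxK _ 1 1 1) /L mul_col_mx !mul_row_col.
  move: (lsubmx (lsubmx x)) (rsubmx (lsubmx x)) (lsubmx (rsubmx x)) (rsubmx (rsubmx x)).
  move=> x1 x2 x3 x4; rewrite [x1]mx11_scalar [x2]mx11_scalar [x3]mx11_scalar [x4]mx11_scalar.
  rewrite !mul_scalar_mx addrA => /free[-> -> -> ->].
  by rewrite !raddf0 !row_mx0.
case/row_freeP => N; rewrite -[N]hsubmxK mul_col_row => /esym.
rewrite scalar_mx_block => /eq_block_mx[e1 _ e2 _].
exact: similar_dr0 (esym e1) (esym e2).
Qed.

(** The trace-zero representative of a scalar plus a matrix of rank one, the exceptional class in
    size five. *)
Definition diag5 (mu : K) : 'M[K]_5 := mxl 5 5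
  [:: [:: mu; 0; 0; 0; 0]; [:: 0; mu; 0; 0; 0]; [:: 0; 0; mu; 0; 0]; [:: 0; 0; 0; mu; 0];
      [:: 0; 0; 0; 0; - 4 * mu]].

Lemma rep_diag5_anticomm p mu : p != 0 -> rep false p p false (diag5 mu).
Proof.
move=> p0; apply: rep_weaken.
pose V := mxl 5 5 [:: [:: 0; 1; 0; 0; 0 : K]; [:: 0; 0; 1; 0; 0]; [:: 0; 0; 0; 1; 0];
                      [:: 0; 0; 0; 0; 1]; [:: 1; 0; 0; 0; 0]].
pose c := mu / p.
(* Cyclically consecutive terms of [-2, 3, -2, 3, -2] add up to [1] four times and to [-4] once. *)
pose U := mxl 5 5 [:: [:: 0; 0; 0; 0; - 2 * c]; [:: 3 * c; 0; 0; 0; 0];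
   [:: 0; - 2 * c; 0; 0; 0]; [:: 0; 0; 3 * c; 0; 0]; [:: 0; 0; 0; - 2 * c; 0]].
have -> : diag5 mu = twist false p p (diag_nat K 5) U V.
  by rewrite /twist /diag5 /U /V /c; mx_entries; field.
apply: rep_diag_nat => //.
- by case=> [[|[|[|[|[|?]]]]] ?]; rewrite // mxE.
- by case=> [[|[|[|[|[|?]]]]] ?]; rewrite // mxE.
have /mulmx1_unit[] // : V *m mxl 5 5 [:: [:: 0; 0; 0; 0; 1]; [:: 1; 0; 0; 0; 0];
  [:: 0; 1; 0; 0; 0]; [:: 0; 0; 1; 0; 0]; [:: 0; 0; 0; 1; 0]] = 1%:M.
by rewrite /V; mx_entries; ring.
Qed.

Lemma rep_diag5_comm mu : rep true 1 (-1) false (diag5 mu).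
Proof.
have nz3 : (3 : K) != 0 by rewrite natK.
(* The subdiagonal [T] with entries [mu, 2 mu, 3 mu, 4 mu] satisfies [[D, T] = diag5 mu]. The
   diagonal of [V] drops by [3, 3, 3, -2], so [T = [U, V]] for [U] with entries
   [mu/3, 2 mu/3, mu, -2 mu]; they sum to zero, as [U = [D, Y]] requires. Trace zero of [V] fixes
   its first entry [5]. *)
pose D := mxl 5 5 [:: [:: 0; 1; 0; 0; 0 : K]; [:: 0; 0; 1; 0; 0]; [:: 0; 0; 0; 1; 0];
                      [:: 0; 0; 0; 0; 1]; [:: 0; 0; 0; 0; 0]].
pose Y := mxl 5 5 [:: [:: 0; 0; 0; 0; 0]; [:: 0; 0; 0; 0; 0]; [:: mu / 3; 0; 0; 0; 0];
                      [:: 0; mu; 0; 0; 0]; [:: 0; 0; 2 * mu; 0; 0]].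
pose Z := mxl 5 5 [:: [:: 0; 0; 0; 0; 0 : K]; [:: 5; 0; 0; 0; 0]; [:: 0; 7; 0; 0; 0];
                      [:: 0; 0; 6; 0; 0]; [:: 0; 0; 0; 2; 0]].
exists D, Y, Z; split=> //.
have -> : mxcomm D Y = mxl 5 5 [:: [:: 0; 0; 0; 0; 0]; [:: mu / 3; 0; 0; 0; 0];
    [:: 0; 2 * mu / 3; 0; 0; 0]; [:: 0; 0; mu; 0; 0]; [:: 0; 0; 0; - 2 * mu; 0]].
  by rewrite /mxcomm /D /Y; mx_entries; field.
have -> : mxcomm D Z = mxl 5 5 [:: [:: 5; 0; 0; 0; 0]; [:: 0; 2; 0; 0; 0];
    [:: 0; 0; -1; 0; 0]; [:: 0; 0; 0; - 4; 0]; [:: 0; 0; 0; 0; - 2]].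
  by rewrite /mxcomm /D /Z; mx_entries; ring.
rewrite /twist; set T := _ + _.
have -> : T = mxl 5 5 [:: [:: 0; 0; 0; 0; 0]; [:: mu; 0; 0; 0; 0];
    [:: 0; 2 * mu; 0; 0; 0]; [:: 0; 0; 3 * mu; 0; 0]; [:: 0; 0; 0; 4 * mu; 0]].
  by rewrite /T; mx_entries; field.
by rewrite /mxcomm /D /diag5; mx_entries; ring.
Qed.

Definition row5 (x0 x1 x2 x3 x4 : K) : 'rV[K]_5 := mxl 1 5 [:: [:: x0; x1; x2; x3; x4]].

Lemma mulmx_row5 x0 x1 x2 x3 x4 (B : 'M[K]_5) :
  row5 x0 x1 x2 x3 x4 *m B =
  x0 *: row (inord 0) B + x1 *: row (inord 1) B + x2 *: row (inord 2) B +
  x3 *: row (inord 3) B + x4 *: row (inord 4) B.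
Proof.
apply/rowP => j; rewrite !mxE !big_ord_recl big_ord0 !mxE /bump /= addr0 !addrA.
by congr (_ + _ + _ + _ + _); congr (_ * B _ _); apply: val_inj; rewrite /= inordK.
Qed.

Lemma row5E (x : 'rV[K]_5) : exists x0 x1 x2 x3 x4, x = row5 x0 x1 x2 x3 x4.
Proof.
exists (x 0 (inord 0)), (x 0 (inord 1)), (x 0 (inord 2)), (x 0 (inord 3)), (x 0 (inord 4)).
apply/rowP; case=> [[|[|[|[|[|?]]]]] ?] //; rewrite mxE /=;
by congr (x _ _); apply: val_inj; rewrite /= inordK.
Qed.

Lemma row5_eq0 x0 x1 x2 x3 x4 :
  row5 x0 x1 x2 x3 x4 = 0 -> [/\ x0 = 0, x1 = 0, x2 = 0, x3 = 0 & x4 = 0].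
Proof.
move/rowP => e; have f m : (m < 5)%N -> nth 0 [:: x0; x1; x2; x3; x4] m = 0.
  by move=> lm; have := e (Ordinal lm); rewrite !mxE.
by split; [apply: (f 0%N) | apply: (f 1%N) | apply: (f 2%N) | apply: (f 3%N) | apply: (f 4%N)].
Qed.

Lemma row5D x0 x1 x2 x3 x4 y0 y1 y2 y3 y4 :
  row5 x0 x1 x2 x3 x4 + row5 y0 y1 y2 y3 y4 =
  row5 (x0 + y0) (x1 + y1) (x2 + y2) (x3 + y3) (x4 + y4).
Proof. by apply/rowP; case=> [[|[|[|[|[|?]]]]] ?] //; rewrite !mxE. Qed.

Lemma row5Z c x0 x1 x2 x3 x4 :
  c *: row5 x0 x1 x2 x3 x4 = row5 (c * x0) (c * x1) (c * x2) (c * x3) (c * x4).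
Proof. by apply/rowP; case=> [[|[|[|[|[|?]]]]] ?] //; rewrite !mxE. Qed.

Lemma det2_eq0 (a b c d x y : K) :
  a * d - b * c != 0 -> x * a + y * b = 0 -> x * c + y * d = 0 -> x = 0 /\ y = 0.
Proof.
move=> nz e1 e2; split; apply: (mulIf nz).
  have -> : x * (a * d - b * c) = (x * a + y * b) * d - (x * c + y * d) * b by ring.
  by rewrite e1 e2 !mul0r subr0.
have -> : y * (a * d - b * c) = (x * c + y * d) * a - (x * a + y * b) * c by ring.
by rewrite e1 e2 !mul0r subr0.
Qed.

(* Unless [A] is a scalar plus a matrix of rank one, some two-dimensional space of row vectors is
   independent of its image under [A]; this yields the zero block. *)
Lemma similar5 (A : 'M[K]_5) : zero_diag A ->
  (exists2 B, similar_mx A B & drsubmx (B : 'M_(3 + 2)) = 0) \/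
  (exists mu, similar_mx A (diag5 mu)).
Proof.
move=> z0.
case: (pickP (fun ij : 'I_5 * 'I_5 => A ij.1 ij.2 != 0)) => [[i j] /= nzij|A0]; last first.
  left; exists A; first exact: similar_mx_refl.
  by apply/matrixP => i j; rewrite !mxE; apply/eqP/negbFE/(A0 (_, _)).
have nij : i != j by apply: contra nzij => /eqP ->; rewrite z0.
(* Since [(i, j)] is off the diagonal, [e_i] and [e_i A] are independent and can start a basis; row
   [0] of [B] is then the second basis vector. *)
have fL : row_free (col_mx (delta_mx 0 i) (row i A) : 'M[K]_(1 + 1, 2 + 3)).
  apply: inj_row_free => x; rewrite -[x]hsubmxK mul_row_col.
  move: (lsubmx x) (rsubmx x) => y z; rewrite [y]mx11_scalar [z]mx11_scalar !mul_scalar_mx.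
  move/rowP => e; have := e j; rewrite !mxE (_ : (j == i) = false) ?andbF; last first.
    by rewrite eq_sym (negPf nij).
  rewrite mulr0 add0r => /eqP; rewrite mulf_eq0 (negPf nzij) orbF => /eqP z00.
  have := e i; rewrite !mxE !eqxx z00 mul0r addr0 mulr1 => ->.
  by rewrite !raddf0 row_mx0.
have [P uP eP] := complete_rows fL; pose B : 'M[K]_5 := P *m A *m invmx P.
have SAB : similar_mx A B by exists P => //; rewrite /B mulmxKV.
have rP (k : 'I_(1 + 1)) : row (lshift 3 k) P = row k (col_mx (delta_mx 0 i) (row i A)).
  by rewrite -eP row_mul row_row_mx row1 row0 -delta_mx_lshift -rowE.
have P0 : row (inord 0) P = delta_mx 0 i.
  have := rP (lshift 1 0); rewrite rowKu row_id => <-.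
  by congr row; apply: val_inj; rewrite /= inordK.
have P1 : row (inord 1) P = row i A.
  have := rP (rshift 1 0); rewrite rowKd row_id => <-.
  by congr row; apply: val_inj; rewrite /= inordK.
have B0 : row (inord 0) B = row5 0 1 0 0 0.
  rewrite /B !row_mul P0 -rowE -P1 -row_mul mulmxV // row1.
  by apply/rowP; case=> [[|[|[|[|[|?]]]]] ?] //; rewrite !mxE eqxx /= -val_eqE /= inordK.
have trB : \tr B = 0.
  by rewrite -(similar_mx_trace SAB) /mxtrace big1 // => k _; apply: z0.
have [b10 [b11 [b12 [b13 [b14 B1]]]]] := row5E (row (inord 1) B).
have [b20 [b21 [b22 [b23 [b24 B2]]]]] := row5E (row (inord 2) B).
have [b30 [b31 [b32 [b33 [b34 B3]]]]] := row5E (row (inord 3) B).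
have [b40 [b41 [b42 [b43 [b44 B4]]]]] := row5E (row (inord 4) B).
clearbody B; have {P uP eP rP P0 P1 fL} WB (v w : 'rV[K]_5) :
    (forall x1 x2 x3 x4, x1 *: v + x2 *: w + x3 *: (v *m B) + x4 *: (w *m B) = 0 ->
    [/\ x1 = 0, x2 = 0, x3 = 0 & x4 = 0]) ->
    exists2 B, similar_mx A B & drsubmx (B : 'M_(3 + 2)) = 0.
  move=> h; have [C SC C0] := @similar_dr0_rows 3 B v w h; exists C => //.
  exact: similar_mx_trans SAB SC.
have eB : B = mxl 5 5 [:: [:: 0; 1; 0; 0; 0]; [:: b10; b11; b12; b13; b14];
    [:: b20; b21; b22; b23; b24]; [:: b30; b31; b32; b33; b34]; [:: b40; b41; b42; b43; b44]].
  apply/row_matrixP => k; rewrite -[k]inord_val.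
  case: k => [[|[|[|[|[|?]]]]] ?] //=; rewrite (B0, B1, B2, B3, B4);
  by apply/rowP => l; rewrite !mxE /= inordK.
have mulB x0 x1 x2 x3 x4 : row5 x0 x1 x2 x3 x4 *m B =
    row5 (x1 * b10 + x2 * b20 + x3 * b30 + x4 * b40)
         (x0 + x1 * b11 + x2 * b21 + x3 * b31 + x4 * b41)
         (x1 * b12 + x2 * b22 + x3 * b32 + x4 * b42)
         (x1 * b13 + x2 * b23 + x3 * b33 + x4 * b43)
         (x1 * b14 + x2 * b24 + x3 * b34 + x4 * b44).
  by rewrite mulmx_row5 B0 B1 B2 B3 B4 !row5Z !row5D !mulr0 !add0r mulr1.
(* Witnesses spanned by the first basis row [e0], with [e0 *m B = e1], and another row [w]. *)
have W0 w0 w1 w2 w3 w4 y0 y1 y2 y3 y4 : row5 w0 w1 w2 w3 w4 *m B = row5 y0 y1 y2 y3 y4 ->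
    [|| w2 * y3 - y2 * w3 != 0, w3 * y4 - y3 * w4 != 0 | w2 * y4 - y2 * w4 != 0] ->
    exists2 B, similar_mx A B & drsubmx (B : 'M_(3 + 2)) = 0.
  move=> ey nz; apply: (WB (row5 1 0 0 0 0) (row5 w0 w1 w2 w3 w4)) => x1 x2 x3 x4.
  rewrite ey mulB !row5Z !row5D => /row5_eq0[]; rewrite !(mulr0, mul0r, mulr1, add0r, addr0).
  move=> e0 e1 e2 e3 e4; suff [x20 x40] : x2 = 0 /\ x4 = 0.
    by move: e0 e1; rewrite x20 x40 !mul0r !add0r !addr0 => -> ->.
  by case/or3P: nz => /det2_eq0; apply.
(* Taking [w] among [e2], [e3], [e4] leaves the case where the lower right block of size three is
   diagonal. *)
case: (boolP [&& b23 == 0, b24 == 0, b32 == 0, b34 == 0, b42 == 0 & b43 == 0]); last first.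
  rewrite !negb_and => nz; left; case/or4P: nz => [nz|nz|nz|/or3P[nz|nz|nz]].
  - apply: (W0 0 0 1 0 0); first exact: mulB.
    by rewrite !(mul0r, mul1r, mulr0, mulr1, add0r, addr0, subr0, sub0r, oppr0) nz.
  - apply: (W0 0 0 1 0 0); first exact: mulB.
    by rewrite !(mul0r, mul1r, mulr0, mulr1, add0r, addr0, subr0, sub0r, oppr0) nz !orbT.
  - apply: (W0 0 0 0 1 0); first exact: mulB.
    by rewrite !(mul0r, mul1r, mulr0, mulr1, add0r, addr0, subr0, sub0r, oppr0, oppr_eq0) nz.
  - apply: (W0 0 0 0 1 0); first exact: mulB.
    by rewrite !(mul0r, mul1r, mulr0, mulr1, add0r, addr0, subr0, sub0r, oppr0, oppr_eq0) nz !orbT.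
  - apply: (W0 0 0 0 0 1); first exact: mulB.
    by rewrite !(mul0r, mul1r, mulr0, mulr1, add0r, addr0, subr0, sub0r, oppr0, oppr_eq0) nz !orbT.
  apply: (W0 0 0 0 0 1); first exact: mulB.
  by rewrite !(mul0r, mul1r, mulr0, mulr1, add0r, addr0, subr0, sub0r, oppr0, oppr_eq0) nz !orbT.
case/and5P => /eqP b23_0 /eqP b24_0 /eqP b32_0 /eqP b34_0 /andP[/eqP b42_0 /eqP b43_0].
move: mulB eB; rewrite {}b23_0 {}b24_0 {}b32_0 {}b34_0 {}b42_0 {}b43_0 => mulB eB.
(* Sums of two basis vectors then make that block the scalar [mu] and clear the end of row [1]. *)
case: (boolP [&& b12 == 0, b13 == 0, b14 == 0, b33 == b22 & b44 == b22]); last first.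
  rewrite !negb_and => nz; left; case/or4P: nz => [nz|nz|nz|/orP[nz|nz]].
  - apply: (W0 0 1 0 1 0); first exact: mulB.
    by rewrite !(mul0r, mul1r, mulr0, mulr1, add0r, addr0, subr0, sub0r, oppr0, oppr_eq0) nz.
  - apply: (W0 0 1 1 0 0); first exact: mulB.
    by rewrite !(mul0r, mul1r, mulr0, mulr1, add0r, addr0, subr0, sub0r, oppr0, oppr_eq0) nz.
  - apply: (W0 0 1 1 0 0); first exact: mulB.
    by rewrite !(mul0r, mul1r, mulr0, mulr1, add0r, addr0, subr0, sub0r, oppr0, oppr_eq0) nz !orbT.
  - apply: (W0 0 0 1 1 0); first exact: mulB.
    by rewrite !(mul0r, mul1r, mulr0, mulr1, add0r, addr0, subr0, sub0r, oppr0) subr_eq0 nz.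
  apply: (W0 0 0 1 0 1); first exact: mulB.
  by rewrite !(mul0r, mul1r, mulr0, mulr1, add0r, addr0, subr0, sub0r, oppr0) subr_eq0 nz !orbT.
case/and5P => /eqP b12_0 /eqP b13_0 /eqP b14_0 /eqP b33_0 /eqP b44_0.
move: mulB eB; rewrite {}b12_0 {}b13_0 {}b14_0 {}b33_0 {}b44_0 => mulB eB.
set mu := b22 in mulB eB.
have e11 : b11 = - 3 * mu.
  have : b11 + 3 * mu = 0.
    rewrite -[RHS]trB eB /mxtrace !big_ord_recl big_ord0 !mxE /=; ring.
  by move/eqP; rewrite addr_eq0 mulNr => /eqP.
rewrite {}e11 in mulB eB.
(* Only columns [0] and [1] of [B - mu] are nonzero now, so independence comes down to a determinant
   of size two in the entries of [v (B - mu)] and [w (B - mu)]. *)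
have W1 (v w : 'rV[K]_5) r s r' s' : (forall x1 x2 x3 x4,
      x1 *: v + x2 *: w + x3 *: (v *m B) + x4 *: (w *m B) = 0 ->
      [/\ x1 = - mu * x3, x2 = - mu * x4, x3 * r + x4 * r' = 0 & x3 * s + x4 * s' = 0]) ->
    r * s' - r' * s != 0 -> exists2 B, similar_mx A B & drsubmx (B : 'M_(3 + 2)) = 0.
  move=> h nz; apply: (WB v w) => x1 x2 x3 x4 /h[-> -> e1 e2].
  by have [-> ->] := det2_eq0 nz e1 e2; rewrite !mulr0.
have eqN (x y : K) : x + y = 0 -> x = - y by move/eqP; rewrite addr_eq0 => /eqP.
(* This [t] makes the determinant equal to [1]. *)
have dett r s r' s' t : r + mu * s != 0 -> t = (1 - (r * s' - s * r')) / (r + mu * s) ->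
    r * (s' + t) - (r' - mu * t) * s != 0.
  move=> nz ->; set d := _ - _; suff -> : d = 1 by rewrite oner_eq0.
  by rewrite /d; field.
(* The next three cases leave rows [2], [3], [4] of [B - mu] proportional to its row [0], which is
   [(-mu, 1, 0, 0, 0)]. *)
have [r2|nz] := eqVneq (b20 + mu * b21) 0; last first.
  left; pose t := (1 - (b20 * b31 - b21 * b30)) / (b20 + mu * b21).
  apply: (W1 (row5 0 0 1 0 0) (row5 t 0 0 1 0) b20 b21 (b30 - mu * t) (b31 + t)); last exact: dett.
  move=> x1 x2 x3 x4; rewrite !mulB !row5Z !row5D => /row5_eq0[].
  rewrite !(mulr0, mul0r, mulr1, mul1r, add0r, addr0) => e0 e1 /eqN e2 /eqN e3 _.
  have {}e2 : x1 = - mu * x3 by rewrite e2; ring.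
  have {}e3 : x2 = - mu * x4 by rewrite e3; ring.
  by split=> //; [rewrite -[RHS]e0 e3 | rewrite -[RHS]e1]; ring.
have [r3|nz] := eqVneq (b30 + mu * b31) 0; last first.
  left; pose t := (1 - (b30 * b41 - b31 * b40)) / (b30 + mu * b31).
  apply: (W1 (row5 0 0 0 1 0) (row5 t 0 0 0 1) b30 b31 (b40 - mu * t) (b41 + t)); last exact: dett.
  move=> x1 x2 x3 x4; rewrite !mulB !row5Z !row5D => /row5_eq0[].
  rewrite !(mulr0, mul0r, mulr1, mul1r, add0r, addr0) => e0 e1 _ /eqN e2 /eqN e3.
  have {}e2 : x1 = - mu * x3 by rewrite e2; ring.
  have {}e3 : x2 = - mu * x4 by rewrite e3; ring.
  by split=> //; [rewrite -[RHS]e0 e3 | rewrite -[RHS]e1]; ring.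
have [r4|nz] := eqVneq (b40 + mu * b41) 0; last first.
  left; pose t := (1 - (b40 * b21 - b41 * b20)) / (b40 + mu * b41).
  apply: (W1 (row5 0 0 0 0 1) (row5 t 0 1 0 0) b40 b41 (b20 - mu * t) (b21 + t)); last exact: dett.
  move=> x1 x2 x3 x4; rewrite !mulB !row5Z !row5D => /row5_eq0[].
  rewrite !(mulr0, mul0r, mulr1, mul1r, add0r, addr0) => e0 e1 /eqN e3 _ /eqN e2.
  have {}e2 : x1 = - mu * x3 by rewrite e2; ring.
  have {}e3 : x2 = - mu * x4 by rewrite e3; ring.
  by split=> //; [rewrite -[RHS]e0 e3 | rewrite -[RHS]e1]; ring.
have [a1|nz] := eqVneq (b10 - 4 * mu ^+ 2) 0; last first.
  (* The coefficient [1 - b21] gives the first witness the image [(-mu, 1, 0, 0, 0)] under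
     [B - mu]. *)
  left; apply: (W1 (row5 (1 - b21) 0 1 0 0) (row5 0 1 0 1 0)
                   (- mu) 1 (b10 + b30) (- 4 * mu + b31)); last first.
    rewrite [X in X != 0](_ : _ = - (b10 - 4 * mu ^+ 2) - (b30 + mu * b31)); last by ring.
    by rewrite r3 subr0 oppr_eq0.
  move=> x1 x2 x3 x4; rewrite !mulB !row5Z !row5D => /row5_eq0[].
  rewrite !(mulr0, mul0r, mulr1, mul1r, add0r, addr0) => e0 e1 /eqN e2 /eqN e3 _.
  have {}e2 : x1 = - mu * x3 by rewrite e2; ring.
  have {}e3 : x2 = - mu * x4 by rewrite e3; ring.
  split=> //; last by rewrite -[RHS]e1 e3; ring.
  by rewrite -[RHS]e0 e2 (eqN _ _ r2); ring.
move: mulB eB; rewrite (eqN _ _ r2) (eqN _ _ r3) (eqN _ _ r4) => _ eB.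
have {}a1 : b10 = 4 * mu ^+ 2 by apply/eqP; rewrite -subr_eq0 a1.
(* Now [B - mu] has rank one. For [mu = 0] the lower right block is already zero. *)
have [mu0|mu0] := eqVneq mu 0.
  left; exists B => //; rewrite eB mu0; apply/matrixP.
  by case=> [[|[|?]] ?] //; case=> [[|[|?]] ?] //; rewrite !mxE.
have nz5 : (5 : K) != 0 by rewrite natK.
right; exists mu; apply: similar_mx_trans SAB _; rewrite eB a1.
(* The rows of the first matrix are left eigenvectors of [B]: four for [mu], the last for
   [- 4 * mu]. *)
apply: (@similar_by _ _
  (mxl 5 5 [:: [:: 4 * mu; 1; 0; 0; 0]; [:: - b21; 0; 1; 0; 0]; [:: - b31; 0; 0; 1; 0];
               [:: - b41; 0; 0; 0; 1]; [:: - mu; 1; 0; 0; 0]])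
  (mxl 5 5 [:: [:: (5 * mu)^-1; 0; 0; 0; - (5 * mu)^-1]; [:: 5^-1; 0; 0; 0; 4 / 5];
     [:: b21 / (5 * mu); 1; 0; 0; - b21 / (5 * mu)];
     [:: b31 / (5 * mu); 0; 1; 0; - b31 / (5 * mu)];
     [:: b41 / (5 * mu); 0; 0; 1; - b41 / (5 * mu)]])).
  by mx_entries; field; rewrite ?nz5 ?mu0.
by rewrite /diag5; mx_entries; ring.
Qed.

End FiveByFive.

(** * All sizes *)

Section Assembly.

Variable K : closedFieldType.
Hypothesis natK : forall m, (m%:R == 0 :> K) = (m == 0%N).

Lemma zero_diag_trace n (A : 'M[K]_n) : zero_diag A -> \tr A = 0.
Proof. by move=> z; rewrite /mxtrace big1 // => i _; apply: z. Qed.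

Section BlocksOfSizeThree.

Variables (k : bool) (p q : K).
Hypotheses (p0 : p != 0) (q0 : q != 0).
Hypothesis rep_3 : forall A : 'M[K]_3, \tr A = 0 -> rep k p q true A.
Hypothesis rep_diag5 : forall mu, rep k p q false (diag5 mu).

(** Blocks of size three are split off until at most one row remains, where the block is zero. A
    remainder of size two is avoided by stopping at size five, where [similar5] gives a zero block
    or [diag5]. *)
Lemma rep_blocks3 n (A : 'M[K]_n) : (3 <= n)%N -> zero_diag A -> rep k p q false A.
Proof.
have [m] := ubnP n; elim: m n A => // m IH [|[|[|n]]] // A lt_nm _ z0.
have q0' : (q != 0) || false by rewrite q0.
have r3 : rep k p q true (@ulsubmx _ 3 n 3 n A).
  exact/rep_3/zero_diag_trace/(@zero_diag_ul _ 3 n).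
have z2 : zero_diag (@drsubmx _ 3 n 3 n A) by apply: (@zero_diag_dr _ 3 n).
have combine : rep k p q false (@drsubmx _ 3 n 3 n A) -> rep k p q false A.
  move=> r2; have := rep_block (@ursubmx _ 3 n 3 n A) (@dlsubmx _ 3 n 3 n A) p0 q0' r3 r2.
  by rewrite submxK.
case: n => [|[|[|n]]] in A z0 lt_nm r3 z2 combine *.
- by apply: combine; rewrite (_ : drsubmx _ = 0); [exact: rep0 | apply/matrixP; case].
- apply: combine; rewrite (_ : drsubmx _ = 0); first exact: rep0.
  by apply/matrixP => i j; rewrite !ord1 z2 mxE.
- have [[B S B0]|[mu S]] := similar5 natK z0; last exact: rep_similar S _.
  apply: (rep_similar S).
  suff r : rep k p q true (@ulsubmx _ 3 2 3 2 B).
    have r0 : rep k p q false (@drsubmx _ 3 2 3 2 B) by rewrite B0; apply: rep0.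
    have := rep_block (@ursubmx _ 3 2 3 2 B) (@dlsubmx _ 3 2 3 2 B) p0 q0' r r0.
    by rewrite submxK.
  apply: rep_3; have trB : \tr B = 0 by rewrite -(similar_mx_trace S); apply: zero_diag_trace.
  have := mxtrace_block (@ulsubmx _ 3 2 3 2 B) (@ursubmx _ 3 2 3 2 B) (@dlsubmx _ 3 2 3 2 B)
    (@drsubmx _ 3 2 3 2 B).
  by rewrite submxK B0 mxtrace0 addr0 -trB.
apply: combine; apply: IH => //; apply: leq_trans (ltnSE lt_nm).
by rewrite !ltnS !leqW.
Qed.


End BlocksOfSizeThree.

Lemma rep_blocks2 n p q (A : 'M[K]_n) : p != q -> p != 0 -> q != 0 -> zero_diag A ->
  rep false p q false A.
Proof.
move=> pq p0 q0; have [m] := ubnP n; elim: m n A => // m IH [|[|n]] A lt_nm z0.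
- by rewrite (_ : A = 0); [exact: rep0 | apply/matrixP; case].
- rewrite (_ : A = 0); first exact: rep0.
  by apply/matrixP => i j; rewrite !ord1 z0 mxE.
have r2 : rep false p q true (@ulsubmx _ 2 n 2 n A).
  by apply: rep2 => //; apply: (@zero_diag_ul _ 2 n).
have r : rep false p q false (@drsubmx _ 2 n 2 n A).
  apply: IH; last by apply: (@zero_diag_dr _ 2 n).
  by apply: leq_trans (ltnSE lt_nm); rewrite !ltnS !leqW.
have q0' : (q != 0) || false by rewrite q0.
have := rep_block (@ursubmx _ 2 n 2 n A) (@dlsubmx _ 2 n 2 n A) p0 q0' r2 r.
by rewrite submxK.
Qed.

(** For [q = 0] the last block needs an invertible [V] too. Commutators of size one vanish, so odd
    sizes end with a block of size three. *)
Lemma rep_product n p (A : 'M[K]_n) : p != 0 -> n != 1%N -> zero_diag A ->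
  rep false p 0 true A.
Proof.
move=> p0; have [m] := ubnP n; elim: m n A => // m IH [|[|[|[|n]]]] // A lt_nm _ z0.
- exists 0, 0, 0; split; first by apply/matrixP; case.
  by rewrite /= unitmxE det_mx00 unitr1.
- exact: rep2.
- by apply: rep3; rewrite // expr0n addr0 expf_neq0.
have r2 : rep false p 0 true (@ulsubmx _ 2 n.+2 2 n.+2 A).
  by apply: rep2 => //; apply: (@zero_diag_ul _ 2 n.+2).
have r : rep false p 0 true (@drsubmx _ 2 n.+2 2 n.+2 A).
  apply: IH => //; last by apply: (@zero_diag_dr _ 2 n.+2).
  by apply: leq_trans (ltnSE lt_nm); rewrite !ltnS !leqW.
have q0' : ((0 : K) != 0) || true by rewrite orbT.
have := rep_block (@ursubmx _ 2 n.+2 2 n.+2 A) (@dlsubmx _ 2 n.+2 2 n.+2 A) p0 q0' r2 r.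
by rewrite submxK.
Qed.

Lemma rep_anticomm n p (A : 'M[K]_n) : p != 0 -> (3 <= n)%N -> zero_diag A ->
  rep false p p false A.
Proof.
move=> p0; have nz2 : (2 : K) != 0 by rewrite natK.
apply: rep_blocks3 => // [A3 _|mu]; last exact: rep_diag5_anticomm.
by apply: rep3; rewrite // -mulr2n -mulr_natr mulf_neq0 // expf_neq0.
Qed.

Lemma rep_comm n (A : 'M[K]_n) : (3 <= n)%N -> zero_diag A -> rep true 1 (-1) false A.
Proof.
apply: rep_blocks3; [exact: oner_neq0 | by rewrite oppr_eq0 oner_eq0 | |].
  exact: rep3_comm.
exact: rep_diag5_comm.
Qed.

Lemma rep_products n p q (A : 'M[K]_n) : p != 0 -> (3 <= n)%N -> zero_diag A ->
  rep false p q false A.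
Proof.
move=> p0 n3 z0; have [->|pq] := eqVneq q p; first exact: rep_anticomm.
have [->|q0] := eqVneq q 0; last by apply: rep_blocks2; rewrite // eq_sym.
by apply/rep_weaken/rep_product => //; case: n n3 {A z0} => [|[]].
Qed.

End Assembly.

(** * Reduction of a multilinear polynomial of degree four *)

(** Permutations as plain lists, so that finite checks run by computation. *)
Definition orders : seq (seq nat) := [::
  [:: 0; 1; 2; 3]; [:: 0; 1; 3; 2]; [:: 0; 2; 1; 3]; [:: 0; 2; 3; 1];
  [:: 0; 3; 1; 2]; [:: 0; 3; 2; 1]; [:: 1; 0; 2; 3]; [:: 1; 0; 3; 2];
  [:: 1; 2; 0; 3]; [:: 1; 2; 3; 0]; [:: 1; 3; 0; 2]; [:: 1; 3; 2; 0];
  [:: 2; 0; 1; 3]; [:: 2; 0; 3; 1]; [:: 2; 1; 0; 3]; [:: 2; 1; 3; 0];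
  [:: 2; 3; 0; 1]; [:: 2; 3; 1; 0]; [:: 3; 0; 1; 2]; [:: 3; 0; 2; 1];
  [:: 3; 1; 0; 2]; [:: 3; 1; 2; 0]; [:: 3; 2; 0; 1]; [:: 3; 2; 1; 0]]%N.

Definition relabel (t u : seq nat) : seq nat := map (nth 0%N t) u.

(** The default [1] is never reached on [orders]. *)
Definition perm_of_order (t : seq nat) : 'S_4 :=
  odflt (1%g : {perm 'I_4}) (insub [ffun i : 'I_4 => inord (nth 0%N t i) : 'I_4]).

Lemma mem_orders t : t \in orders -> [/\ uniq t, size t = 4 & all (fun m => m < 4)%N t].
Proof.
have : all (fun t => [&& uniq t, size t == 4 & all (fun m => m < 4)%N t]) orders by vm_compute.
by move/allP => h /h/and3P[? /eqP ? ?].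
Qed.

Lemma perm_of_orderE t i : t \in orders -> perm_of_order t i = inord (nth 0%N t i).
Proof.
case/mem_orders => ut st lt; rewrite /perm_of_order insubT => [|h]; last first.
  by rewrite /= -pvalE -[pval _]/(val _) SubK ffunE.
apply/injectiveP => j k; rewrite !ffunE => /(congr1 val) /=.
have lt4 (m : 'I_4) : (nth 0 t m < 4)%N by apply: (allP lt); rewrite mem_nth ?st.
rewrite !inordK ?lt4 // => /eqP; rewrite nth_uniq ?st // => /eqP; exact: val_inj.
Qed.

Lemma orders_complete (s : 'S_4) : exists2 t, t \in orders & s = perm_of_order t.
Proof.
pose t := [seq val (s i) | i <- enum 'I_4].
have st : size t = 4 by rewrite size_map size_enum_ord.
have ut : uniq t by rewrite map_inj_uniq ?enum_uniq // => i j /val_inj/perm_inj.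
have pt : perm_eq t (iota 0 4).
  have [||_ h] := uniq_min_size ut _ _ (s2 := iota 0 4); last exact: uniq_perm ut (iota_uniq 0 4) h.
    by move=> x /mapP[i _ ->]; rewrite mem_iota ltn_ord.
  by rewrite st.
have tO : t \in orders.
  have /allP : all (mem orders) (permutations (iota 0 4)) by vm_compute.
  by apply; rewrite mem_permutations.
exists t => //; apply/permP => i; rewrite perm_of_orderE // /t (nth_map i) ?size_enum_ord //.
by rewrite nth_ord_enum inord_val.
Qed.

Lemma perm_of_order_inj : {in orders &, injective perm_of_order}.
Proof.
move=> t u tO uO e; have [_ st lt] := mem_orders tO; have [_ su lu] := mem_orders uO.
apply: (@eq_from_nth _ 0%N); rewrite st ?su // => m m4.
have := congr1 (fun s : 'S_4 => val (s (Ordinal m4))) e; rewrite /= !perm_of_orderE //.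
by rewrite !inordK //; [apply: (allP lu) | apply: (allP lt)]; rewrite mem_nth ?st ?su.
Qed.

Definition ncpoly (K : fieldType) n (c : seq nat -> K) (X : nat -> 'M[K]_n) : 'M[K]_n :=
  \sum_(u <- orders) c u *: (X (nth 0 u 0) *m X (nth 0 u 1) *m X (nth 0 u 2) *m X (nth 0 u 3))%N.

(** Renaming variables only permutes the arguments, so any variable may be moved to a chosen
    place. *)
Lemma multilin_image_ncpoly (K : fieldType) n (alpha : {ffun 'S_4 -> K}) t (X : nat -> 'M[K]_n) :
  t \in orders ->
  multilin_image alpha (ncpoly (fun u => alpha (perm_of_order (relabel t u))) X).
Proof.
move=> tO; have [ut st lt] := mem_orders tO.
exists (fun i => X (index (i : nat) t)); rewrite /multilin_eval.
have e1 : perm_eq (index_enum {perm 'I_4}) (map perm_of_order (map (relabel t) orders)).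
  have pO : perm_eq orders (map (relabel t) orders).
    have /allP/(_ t tO) // : all (fun t => perm_eq orders (map (relabel t) orders)) orders.
    by vm_compute.
  apply: (@perm_trans _ (map perm_of_order orders)); last exact: perm_map.
  apply: uniq_perm; first exact: index_enum_uniq.
    by rewrite map_inj_in_uniq //; exact: perm_of_order_inj.
  move=> s; rewrite mem_index_enum; apply/esym/mapP.
  by have [u uO ->] := orders_complete s; exists u.
rewrite (perm_big _ e1) !big_map /ncpoly; apply: eq_big_seq => u uO.
have [_ su lu] := mem_orders uO; have relO : relabel t u \in orders.
  have /allP/(_ t tO)/allP/(_ u uO) // :
    all (fun t => all (fun u => relabel t u \in orders) orders) orders by vm_compute.
have lt4 m : (m < 4)%N -> (nth 0 u m < 4)%N by move=> ?; apply: (allP lu); rewrite mem_nth ?su.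
have idx (m : 'I_4) : index (perm_of_order (relabel t u) m : nat) t = nth 0%N u m.
  rewrite perm_of_orderE // inordK; first by rewrite (nth_map 0%N) ?su // index_uniq ?st ?lt4.
  by rewrite (nth_map 0%N) ?su //; apply: (allP lt); rewrite mem_nth ?st ?lt4.
by rewrite !idx.
Qed.

Ltac words := rewrite /ncpoly !big_cons big_nil /=.

(** * Case analysis on the coefficients *)

Section Reduction.

Variable K : closedFieldType.
Hypothesis natK : forall m, (m%:R == 0 :> K) = (m == 0%N).

Lemma zeromxE m n (i : 'I_m) (j : 'I_n) : (0 : 'M[K]_(m, n)) i j = 0.
Proof. by rewrite mxE. Qed.

Lemma mul_diag_natE n (M : 'M[K]_n) i j : (diag_nat K n *m M) i j = (i : nat)%:R * M i j.
Proof. by rewrite mul_diag_mx !mxE. Qed.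

Lemma mul_mx_diag_natE n (M : 'M[K]_n) i j : (M *m diag_nat K n) i j = M i j * (j : nat)%:R.
Proof. by rewrite mul_mx_diag !mxE. Qed.

Ltac diag_words := repeat (rewrite mul_mx_diag_natE || rewrite mul_diag_natE || rewrite -mulmxA).

(** Inverts [c ad_D^m] for [D = diag_nat]; on the diagonal both sides are zero. *)
Lemma ad_diag_nat n m (c : K) (A : 'M[K]_n) : c != 0 -> zero_diag A ->
  exists Z : 'M[K]_n, forall i j : 'I_n, c * ((i : nat)%:R - (j : nat)%:R) ^+ m * Z i j = A i j.
Proof.
move=> c0 z0; exists (\matrix_(i, j) (A i j / (c * ((i : nat)%:R - (j : nat)%:R) ^+ m))) => i j.
rewrite mxE mulrC; have [->|ne] := eqVneq i j; first by rewrite z0 !mul0r.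
by rewrite divfK // mulf_neq0 // expf_neq0 // natrB_neq0.
Qed.

Lemma degree2_solvable n p q (A : 'M[K]_n) : (p != 0) || (q != 0) -> zero_diag A ->
  exists x y, p *: (x *m y) + q *: (y *m x) = A.
Proof.
move=> pq z0; have [pq0|pq0] := eqVneq (p + q) 0; last first.
  exists 1%:M, ((p + q)^-1 *: A).
  by rewrite mul1mx mulmx1 -scalerDl scalerA divff // scale1r.
have eq : q = - p by apply/eqP; rewrite -addr_eq0 addrC pq0.
have p0 : p != 0 by move: pq; rewrite eq oppr_eq0 orbb.
have [Z eZ] := ad_diag_nat 1 p0 z0; exists (diag_nat K n), Z.
by apply/matrixP => i j; rewrite -eZ eq !(addmxE, scalemxE); diag_words; ring.
Qed.

(** Setting a variable to [1] leaves degree two. If all these specializations vanish, then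
    [f(D, Z, D) = - a ad_D^2 (Z)]. *)
Lemma degree3_solvable n (a b c d e f : K) (A : 'M[K]_n) : a != 0 -> zero_diag A ->
  exists x y z, a *: (x *m y *m z) + b *: (x *m z *m y) + c *: (y *m x *m z) +
    d *: (y *m z *m x) + e *: (z *m x *m y) + f *: (z *m y *m x) = A.
Proof.
move=> a0 z0.
case: (boolP ((a + c + d != 0) || (b + e + f != 0))) => [nz|].
  have [y [z <-]] := degree2_solvable nz z0; exists 1%:M, y, z.
  by apply/matrixP => i j; rewrite !(mul1mx, mulmx1) !(addmxE, scalemxE); ring.
rewrite negb_or !negbK => /andP[/eqP h1 /eqP h2].
case: (boolP ((a + b + c != 0) || (d + e + f != 0))) => [nz|].
  have [x [z <-]] := degree2_solvable nz z0; exists x, 1%:M, z.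
  by apply/matrixP => i j; rewrite !(mul1mx, mulmx1) !(addmxE, scalemxE); ring.
rewrite negb_or !negbK => /andP[/eqP h3 /eqP h4].
case: (boolP ((a + b + e != 0) || (c + d + f != 0))) => [nz|].
  have [x [y <-]] := degree2_solvable nz z0; exists x, y, 1%:M.
  by apply/matrixP => i j; rewrite !(mul1mx, mulmx1) !(addmxE, scalemxE); ring.
rewrite negb_or !negbK => /andP[/eqP h5 /eqP h6].
have ea : b + e = - a by apply: subr0_eq; rewrite -[RHS]h5; ring.
have ef : f = a by apply: subr0_eq; rewrite -[RHS](subrr 0) -{1}h2 -h5; ring.
have ec : c = - d - f by apply: subr0_eq; rewrite -[RHS]h6; ring.
have na0 : - a != 0 by rewrite oppr_eq0.
have [Z eZ] := ad_diag_nat 2 na0 z0; exists (diag_nat K n), Z, (diag_nat K n).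
apply/matrixP => i j; rewrite -eZ !(addmxE, scalemxE); diag_words.
have eb : b = - a - e by rewrite -ea addrK.
by rewrite ec ef eb; ring.
Qed.

(* In the three definitions below [c] is the coefficient function of [f]: [c [:: i; j; k; l]] is the
   coefficient of [x_i x_j x_k x_l]. [insert0 c] is the coefficient of [x1 x2 x3] in
   [f(1, x1, x2, x3)], [last3 c] that of [D D D Z] in [f(D, D, D, Z)], and [swap01 c] that of
   [x y x z] in [f(x, x, y, z)]. *)
Definition insert0 (c : seq nat -> K) :=
  c [:: 0; 1; 2; 3]%N + c [:: 1; 0; 2; 3]%N + c [:: 1; 2; 0; 3]%N + c [:: 1; 2; 3; 0]%N.

Definition last3 (c : seq nat -> K) :=
  c [:: 0; 1; 2; 3]%N + c [:: 0; 2; 1; 3]%N + c [:: 1; 0; 2; 3]%N + c [:: 1; 2; 0; 3]%N +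
  c [:: 2; 0; 1; 3]%N + c [:: 2; 1; 0; 3]%N.

Definition swap01 (c : seq nat -> K) := c [:: 0; 2; 1; 3]%N + c [:: 1; 2; 0; 3]%N.

Lemma ncpoly_insert0 n c (A : 'M[K]_n) : insert0 c != 0 -> zero_diag A ->
  exists X, ncpoly c X = A.
Proof.
move=> nz z0; pose d i j k := c [:: 0; i; j; k]%N + c [:: i; 0; j; k]%N +
  c [:: i; j; 0; k]%N + c [:: i; j; k; 0]%N.
have [x [y [z <-]]] := degree3_solvable (d 1 3 2)%N (d 2 1 3)%N (d 2 3 1)%N (d 3 1 2)%N
  (d 3 2 1)%N nz z0.
exists (nth 0 [:: 1%:M; x; y; z]); words; rewrite !(mul1mx, mulmx1).
by apply/matrixP => i j; rewrite !(addmxE, scalemxE, zeromxE) /d /insert0; ring.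
Qed.

(** Proper polynomials in the sense of PI theory: they vanish when any variable is set to [1]. *)
Definition proper (c : seq nat -> K) : Prop :=
  forall t, t \in orders -> insert0 (fun u => c (relabel t u)) = 0.

Lemma proper_insert c i j k l : proper c -> [:: i; j; k; l] \in orders ->
  c [:: i; j; k; l] + c [:: j; i; k; l] + c [:: j; k; i; l] + c [:: j; k; l; i] = 0.
Proof. by move=> pc /pc. Qed.

(** Summing the [proper] relations over the orders of the three copies of [D] forces the
    coefficients [1, -3, 3, -1] up to the factor [last3 c], which is [ad_D^3]. *)
Lemma ncpoly_last3 n c (A : 'M[K]_n) : proper c -> last3 c != 0 -> zero_diag A ->
  exists X, ncpoly c X = A.
Proof.
move=> pc nz z0; have ins i j k l := @proper_insert c i j k l pc.
have [Z eZ] := ad_diag_nat 3 nz z0.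
exists (nth 0 [:: diag_nat K n; diag_nat K n; diag_nat K n; Z]); words.
apply/matrixP => i j; rewrite -eZ !(addmxE, scalemxE, zeromxE); diag_words.
pose S2 := c [:: 0; 1; 3; 2]%N + c [:: 0; 2; 3; 1]%N + c [:: 1; 0; 3; 2]%N +
  c [:: 1; 2; 3; 0]%N + c [:: 2; 0; 3; 1]%N + c [:: 2; 1; 3; 0]%N.
pose S1 := c [:: 0; 3; 1; 2]%N + c [:: 0; 3; 2; 1]%N + c [:: 1; 3; 0; 2]%N +
  c [:: 1; 3; 2; 0]%N + c [:: 2; 3; 0; 1]%N + c [:: 2; 3; 1; 0]%N.
pose S0 := c [:: 3; 0; 1; 2]%N + c [:: 3; 0; 2; 1]%N + c [:: 3; 1; 0; 2]%N +
  c [:: 3; 1; 2; 0]%N + c [:: 3; 2; 0; 1]%N + c [:: 3; 2; 1; 0]%N.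
have nz2 : (2 : K) != 0 by rewrite natK.
have nz3 : (3 : K) != 0 by rewrite natK.
have sum0 (x1 x2 x3 x4 x5 x6 : K) : x1 = 0 -> x2 = 0 -> x3 = 0 -> x4 = 0 -> x5 = 0 -> x6 = 0 ->
  x1 + x2 + x3 + x4 + x5 + x6 = 0 by do 6 move=> ->; rewrite !addr0.
have e2 : S2 = - 3 * last3 c.
  apply: subr0_eq; rewrite -[RHS](sum0 _ _ _ _ _ _ (ins 0 1 2 3 isT) (ins 0 2 1 3 isT)
    (ins 1 0 2 3 isT) (ins 1 2 0 3 isT) (ins 2 0 1 3 isT) (ins 2 1 0 3 isT))%N /S2 /last3; ring.
have e1 : 2 * S1 = - 2 * S2.
  apply: subr0_eq; rewrite -[RHS](sum0 _ _ _ _ _ _ (ins 0 1 3 2 isT) (ins 0 2 3 1 isT)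
    (ins 1 0 3 2 isT) (ins 1 2 3 0 isT) (ins 2 0 3 1 isT) (ins 2 1 3 0 isT))%N /S2 /S1; ring.
have e0 : 3 * S0 = - S1.
  apply: subr0_eq; rewrite -[RHS](sum0 _ _ _ _ _ _ (ins 0 3 1 2 isT) (ins 0 3 2 1 isT)
    (ins 1 3 0 2 isT) (ins 1 3 2 0 isT) (ins 2 3 0 1 isT) (ins 2 3 1 0 isT))%N /S0 /S1; ring.
have {}e1 : S1 = 3 * last3 c by apply: (mulfI nz2); rewrite e1 e2; ring.
have {}e0 : S0 = - last3 c by apply: (mulfI nz3); rewrite e0 e1; ring.
transitivity ((last3 c * (i : nat)%:R ^+ 3 + S2 * (i : nat)%:R ^+ 2 * (j : nat)%:R +
    S1 * (i : nat)%:R * (j : nat)%:R ^+ 2 + S0 * (j : nat)%:R ^+ 3) * Z i j).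
  by rewrite /last3 /S2 /S1 /S0; ring.
by rewrite e2 e1 e0; ring.
Qed.

Definition tail_vanish (c : seq nat -> K) : Prop :=
  forall t, t \in orders -> last3 (fun u => c (relabel t u)) = 0.

(* The coefficients of [f(x, x, y, z)], where [f] is proper and vanishes as soon as three of its
   arguments commute. *)
Lemma swap01_coefs c : proper c -> tail_vanish c ->
  [/\ c [:: 0; 1; 2; 3]%N + c [:: 1; 0; 2; 3]%N = 0,
      c [:: 0; 2; 3; 1]%N + c [:: 1; 2; 3; 0]%N = - swap01 c,
      c [:: 2; 0; 1; 3]%N + c [:: 2; 1; 0; 3]%N = - swap01 c,
      c [:: 2; 0; 3; 1]%N + c [:: 2; 1; 3; 0]%N = swap01 c &
      c [:: 2; 3; 0; 1]%N + c [:: 2; 3; 1; 0]%N = 0].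
Proof.
move=> pc tc; have ins i j k l := @proper_insert c i j k l pc.
have nz2 : (2 : K) != 0 by rewrite natK.
have sum0 (x1 x2 : K) : x1 = 0 -> x2 = 0 -> x1 + x2 = 0 by move=> -> ->; rewrite addr0.
have := tc [:: 0; 1; 2; 3]%N isT; have := tc [:: 0; 1; 3; 2]%N isT.
rewrite /last3 /relabel /= => l2 l3.
have eA : c [:: 0; 1; 2; 3]%N + c [:: 1; 0; 2; 3]%N = 0.
  have r := sum0 _ _ (ins 3 0 1 2 isT) (ins 3 1 0 2 isT).
  by rewrite -[RHS](subrr 0) -{1}r -l2; ring.
have eC : c [:: 0; 2; 3; 1]%N + c [:: 1; 2; 3; 0]%N = - swap01 c.
  have r := sum0 _ _ (ins 0 1 2 3 isT) (ins 1 0 2 3 isT).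
  apply: subr0_eq; rewrite -[RHS](subrr 0) -{1}r -[X in _ = _ - X](mulr0 2) -eA /swap01; ring.
have eD : c [:: 2; 0; 1; 3]%N + c [:: 2; 1; 0; 3]%N = - swap01 c.
  by apply: subr0_eq; rewrite -[RHS](subrr 0) -{1}l3 -eA /swap01; ring.
have eE : c [:: 2; 0; 3; 1]%N + c [:: 2; 1; 3; 0]%N = swap01 c.
  have r := sum0 _ _ (ins 0 2 1 3 isT) (ins 1 2 0 3 isT).
  have eD0 : c [:: 2; 0; 1; 3]%N + c [:: 2; 1; 0; 3]%N + swap01 c = 0 by rewrite eD addNr.
  apply: subr0_eq; rewrite -[RHS](subrr 0) -{1}r -[X in _ = _ - X](mulr0 2) -eD0 /swap01; ring.
split=> //; have r := sum0 _ _ (ins 0 2 3 1 isT) (ins 1 2 3 0 isT).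
have CE : (c [:: 0; 2; 3; 1]%N + c [:: 1; 2; 3; 0]%N) +
    (c [:: 2; 0; 3; 1]%N + c [:: 2; 1; 3; 0]%N) = 0.
  by rewrite eC eE addNr.
by apply: (mulfI nz2); rewrite mulr0 -[RHS](subrr 0) -{1}r -CE; ring.
Qed.

(** Associativity and closure of composition, computed over all triples of orders. *)
Lemma relabel_comp t u v : t \in orders -> u \in orders -> v \in orders ->
  relabel t (relabel u v) = relabel (relabel t u) v /\ relabel t u \in orders.
Proof.
move=> tO uO vO; have /allP/(_ t tO)/allP/(_ u uO)/allP/(_ v vO)/andP[/eqP -> ->] // :
  all (fun t => all (fun u => all (fun v => (relabel t (relabel u v) == relabel (relabel t u) v) &&
    (relabel t u \in orders)) orders) orders) orders by vm_compute.
Qed.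

Lemma insert0_eq c d : {in orders, c =1 d} -> insert0 c = insert0 d.
Proof. by move=> h; rewrite /insert0 !h. Qed.

Lemma last3_eq c d : {in orders, c =1 d} -> last3 c = last3 d.
Proof. by move=> h; rewrite /last3 !h. Qed.

Lemma proper_relabel c t : t \in orders -> proper c -> proper (fun u => c (relabel t u)).
Proof.
move=> tO pc u uO; rewrite -[RHS](pc (relabel t u)); last first.
  by have [_] := relabel_comp tO uO uO.
by apply: insert0_eq => v vO; have [->] := relabel_comp tO uO vO.
Qed.

Lemma tail_vanish_relabel c t : t \in orders -> tail_vanish c ->
  tail_vanish (fun u => c (relabel t u)).
Proof.
move=> tO pc u uO; rewrite -[RHS](pc (relabel t u)); last first.
  by have [_] := relabel_comp tO uO uO.
by apply: last3_eq => v vO; have [->] := relabel_comp tO uO vO.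
Qed.

(** Applying [swap01_coefs] also after exchanging the last two variables gives [f(D, D, Y, Z) = p
    [D, Y] [D, Z] + q [D, Z] [D, Y]] with [p = swap01 c]. *)
Lemma ncpoly_swap01 n c (A : 'M[K]_n) : proper c -> tail_vanish c -> swap01 c != 0 ->
  (3 <= n)%N -> zero_diag A -> exists X, ncpoly c X = A.
Proof.
move=> pc tc nz n3 z0.
have s23 : [:: 0; 1; 3; 2]%N \in orders by [].
have [eA eC eD eE eF] := swap01_coefs pc tc.
have := swap01_coefs (proper_relabel s23 pc) (tail_vanish_relabel s23 tc).
rewrite {1 2 3}/swap01 /relabel /= => -[eA' eC' eD' eE' eF'].
pose q := c [:: 0; 3; 1; 2]%N + c [:: 1; 3; 0; 2]%N.
have [D [Y [Z [<- _]]]] := rep_products natK q nz n3 z0.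
exists (nth 0 [:: D; D; Y; Z]); words.
rewrite /twist /mxcomm !(mulmxBl, mulmxBr) !mulmxA.
have mv (x y z : K) : x + y = z -> y = z - x by move=> <-; rewrite addrC addKr.
apply/matrixP => i j; rewrite !(addmxE, oppmxE, scalemxE, zeromxE).
have ep : c [:: 1; 2; 0; 3]%N = swap01 c - c [:: 0; 2; 1; 3]%N by rewrite /swap01; ring.
have eq : c [:: 1; 3; 0; 2]%N = q - c [:: 0; 3; 1; 2]%N by rewrite /q; ring.
rewrite -/q in eC' eD' eE'.
rewrite (mv _ _ _ eA) (mv _ _ _ eC) (mv _ _ _ eD) (mv _ _ _ eE) (mv _ _ _ eF).
rewrite (mv _ _ _ eA') (mv _ _ _ eC') (mv _ _ _ eD') (mv _ _ _ eE') (mv _ _ _ eF') ep eq.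
by ring.
Qed.

(** The conclusion says that [c] is alternating, so [f] is a multiple of [s_4]. *)
Lemma swap01_vanish c : proper c -> tail_vanish c ->
  (forall t, t \in orders -> swap01 (fun u => c (relabel t u)) = 0) ->
  forall i j k l, [:: i; j; k; l] \in orders ->
  [/\ c [:: j; i; k; l] = - c [:: i; j; k; l], c [:: i; k; j; l] = - c [:: i; j; k; l] &
      c [:: i; j; l; k] = - c [:: i; j; k; l]].
Proof.
move=> pc tc sc.
have aux t : t \in orders -> _ := fun tO =>
  swap01_coefs (proper_relabel tO pc) (tail_vanish_relabel tO tc).
have eqN (x y : K) : x + y = 0 -> y = - x by move/eqP; rewrite addrC addr_eq0 => /eqP.
move=> i j k l tO; split.
- by have [/eqN] := aux _ tO.
- have uO : [:: j; k; i; l] \in orders.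
    by have [_] := relabel_comp tO (isT : [:: 1; 2; 0; 3]%N \in orders) tO.
  by have [_ _] := aux _ uO; rewrite (sc _ uO) oppr0 => /eqN.
have uO : [:: k; l; i; j] \in orders.
  by have [_] := relabel_comp tO (isT : [:: 2; 3; 0; 1]%N \in orders) tO.
by have [_ _ _ _ /eqN] := aux _ uO.
Qed.

Lemma ncpoly_alternating n c (A : 'M[K]_n) :
  (forall i j k l, [:: i; j; k; l] \in orders ->
  [/\ c [:: j; i; k; l] = - c [:: i; j; k; l], c [:: i; k; j; l] = - c [:: i; j; k; l] &
      c [:: i; j; l; k] = - c [:: i; j; k; l]]) ->
  c [:: 0; 1; 2; 3]%N != 0 -> (3 <= n)%N -> zero_diag A -> exists X, ncpoly c X = A.
Proof.
move=> alt c0 n3 z0; set c1 := c _ in c0.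
have z0' : zero_diag (c1^-1 *: A) by move=> i; rewrite mxE z0 mulr0.
have [D [Y [Z [eA _]]]] := rep_comm natK n3 z0'.
have {}eA : A = c1 *: twist true 1 (-1) D (mxcomm D Y) (mxcomm D Z).
  by rewrite eA scalerA divff // scale1r.
exists (nth 0 [:: D; D *m D; Y; Z]); words; rewrite eA /twist /mxcomm.
have s1 i j k l h := let: And3 e _ _ := @alt i j k l h in e.
have s2 i j k l h := let: And3 _ e _ := @alt i j k l h in e.
have s3 i j k l h := let: And3 _ _ e := @alt i j k l h in e.
(* Each rewrite is one transposition of neighbours; together they bring every coefficient to [c1] up
   to sign. *)
rewrite (s1 2 3 1 0 isT)%N (s2 2 1 3 0 isT)%N (s1 1 3 2 0 isT)%N (s1 2 3 0 1 isT)%N.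
rewrite (s2 1 2 3 0 isT)%N (s1 1 2 3 0 isT)%N (s2 2 0 3 1 isT)%N (s1 0 3 2 1 isT)%N.
rewrite (s1 1 3 0 2 isT)%N (s2 0 2 3 1 isT)%N (s3 1 2 0 3 isT)%N (s2 1 0 3 2 isT)%N.
rewrite (s1 0 2 3 1 isT)%N (s1 1 2 0 3 isT)%N (s1 0 3 1 2 isT)%N (s3 0 2 1 3 isT)%N.
rewrite (s2 0 1 3 2 isT)%N (s1 0 1 3 2 isT)%N (s2 1 0 2 3 isT)%N (s1 0 2 1 3 isT)%N.
rewrite (s3 0 1 2 3 isT)%N (s2 0 1 2 3 isT)%N (s1 0 1 2 3 isT)%N.
rewrite -/c1 !(scale1r, scaleN1r) !(mulmxBl, mulmxBr, mulmxDl, mulmxDr, mulNmx, mulmxN) !mulmxA.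
by apply/matrixP => i j; rewrite !(addmxE, oppmxE, scalemxE, zeromxE); ring.
Qed.

Lemma ncpoly_solvable n c (A : 'M[K]_n) : (3 <= n)%N -> zero_diag A ->
  c [:: 0; 1; 2; 3]%N != 0 ->
  exists t X, t \in orders /\ ncpoly (fun u => c (relabel t u)) X = A.
Proof.
move=> n3 z0 c0; pose cr t u := c (relabel t u).
have [/hasP[t tO nz]|/hasPn pc] := boolP (has (fun t => insert0 (cr t) != 0) orders).
  by have [X eX] := ncpoly_insert0 nz z0; exists t, X.
have {}pc : proper c by move=> t /pc; rewrite negbK => /eqP.
have [/hasP[t tO nz]|/hasPn tc] := boolP (has (fun t => last3 (cr t) != 0) orders).
  by have [X eX] := ncpoly_last3 (proper_relabel tO pc) nz z0; exists t, X.
have {}tc : tail_vanish c by move=> t /tc; rewrite negbK => /eqP.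
have [/hasP[t tO nz]|/hasPn sc] := boolP (has (fun t => swap01 (cr t) != 0) orders).
  have [X eX] := ncpoly_swap01 (proper_relabel tO pc) (tail_vanish_relabel tO tc) nz n3 z0.
  by exists t, X.
have {}sc t : t \in orders -> swap01 (cr t) = 0 by move=> /sc; rewrite negbK => /eqP.
have [X eX] := ncpoly_alternating (swap01_vanish pc tc sc) c0 n3 z0.
exists [:: 0; 1; 2; 3]%N, X; split=> //; rewrite -eX; apply: eq_big_seq => u uO.
have /allP/(_ u uO)/eqP -> // : all (fun u => relabel [:: 0; 1; 2; 3]%N u == u) orders.
by vm_compute.
Qed.

End Reduction.

Lemma multilin_image_similar (K : fieldType) n (alpha : {ffun 'S_4 -> K}) (A B : 'M[K]_n) :
  similar_mx A B -> multilin_image alpha B -> multilin_image alpha A.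
Proof.
move=> [P uP /(similar_mxE uP) ->] [a <-]; exists (fun i => invmx P *m a i *m P).
rewrite /multilin_eval mulmx_sumr mulmx_suml; apply: eq_bigr => s _.
by rewrite -scalemxAr -scalemxAl !mulmxA !mulmxK.
Qed.

Theorem theorem4p1 (K : closedFieldType) (n : nat)
  (charK0 : [pchar K] =i pred0) (hn : (3 <= n)%N)
  (alpha : {ffun 'S_4 -> K}) (alpha_nz : alpha != 0) :
  forall A : 'M[K]_n, \tr A = 0 -> multilin_image alpha A.
Proof.
move=> A trA; have natK : forall m, (m%:R == 0 :> K) = (m == 0%N) by apply/pcharf0P.
have [Z SZ z0] := similar_zero_diag natK trA; apply: multilin_image_similar SZ _.
have [s nz] : exists s, alpha s != 0.
  apply/existsP; apply: contraNT alpha_nz => /existsPn h.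
  by apply/eqP/ffunP => s; rewrite ffunE; apply/eqP/negbNE/h.
have [t tO es] := orders_complete s.
(* Renaming through [t] moves a nonzero coefficient to the word [[:: 0; 1; 2; 3]]. *)
pose c u := alpha (perm_of_order (relabel t u)).
have c0 : c [:: 0; 1; 2; 3]%N != 0.
  rewrite /c (_ : relabel t _ = t) -?es //.
  by have [_] := mem_orders tO; case: t {es c tO} => [|? [|? [|? [|? []]]]].
have [u [X [uO <-]]] := ncpoly_solvable natK hn z0 c0.
have [_ vO] := relabel_comp tO uO uO.
rewrite (_ : ncpoly _ X = ncpoly (fun v => alpha (perm_of_order (relabel (relabel t u) v))) X).
  exact: multilin_image_ncpoly.
by apply: eq_big_seq => v vO'; rewrite /c; have [-> _] := relabel_comp tO uO vO'.
Qed.
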